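(* Let $n\ge1$ and let $D$ be a Dyck path of semi-length $n+1$. Assume that $D$ does not have an ascent longer than $1$ step except for ascents beginning on the $x$-axis. Then the dimension $d_D$ of the homogeneous module $S(\Psi(D))$ is given by $$d_D=\frac{k!}{\prod p_D(i,j)},$$ where $k=(\text{sum of peak heights})-(\text{number of peaks})$ for the path $D$ and the product runs over all blocks $T_i^j$ on the extended ascents of $D$.
   Context: Dyck paths. A Dyck path of semi-length $m$ is a lattice path from $(0,0)$ to $(2m,0)$ with steps $\langle 1,1\rangle$ (rise) and $\langle 1,-1\rangle$ (fall) that never goes below the $x$-axis. A peak is a rise immediately followed by a fall, located at the common endpoint of the two steps, with height the $y$-coordinate of that point. An ascent is a maximal run of consecutive rises; its length is its number of steps. Blocks. For $1\le i\le j\le n$ put $T_i^j=[j,j-1,\dots,i+1,i]$ and associate to it the unit diamond (block) with center $(i+j,j-i+1)$ and top vertex $(i+j,j-i+2)$; its upper-left edge lies on the line $x-y=2i-2$. Every peak of $D$ of height $\ge2$ is located at the top vertex of exactly one block. The map $\Psi$. Let $T_{i_1}^{m_1},\dots,T_{i_\ell}^{m_\ell}$ be the blocks at the peaks of $D$ of height $\ge2$, read from left to right (peaks of height $1$ are ignored). The concatenated word $T_{i_1}^{m_1}T_{i_2}^{m_2}\cdots T_{i_\ell}^{m_\ell}$ is a reduced word of a fully commutative element of the Coxeter group of type $A_n$. $\Psi(D)$ denotes this element, and equally the homogeneous component $C$ consisting of all of its reduced words, i.e. all words obtained from the word above by repeatedly swapping adjacent letters $a,b$ with $|a-b|>1$.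 The module. Let $R_\alpha$ be the KLR (quiver Hecke) algebra of type $A_n$ over a field $\mathbb F$ with generators $e(\boldsymbol w),y_r,\psi_r$, where $\alpha=\sum_i c_i\alpha_i$ and $c_i$ is the number of occurrences of $i$ in the words of $C$. $S(C)$ is the $R_\alpha$-module with $\mathbb F$-basis $\{v_{\boldsymbol w}:\boldsymbol w\in C\}$ and action $e(\boldsymbol w')v_{\boldsymbol w}=\delta_{\boldsymbol w,\boldsymbol w'}v_{\boldsymbol w}$, $y_rv_{\boldsymbol w}=0$, $\psi_rv_{\boldsymbol w}=v_{s_r\boldsymbol w}$ if $s_r\boldsymbol w\in C$ and $0$ otherwise ($s_r$ swaps the letters in positions $r,r+1$). Extended ascents. For each peak of $D$, extend the ascent ending at that peak down and to the left along its line of slope $1$ until it meets the $x$-axis; the resulting segment from the $x$-axis to the peak is an extended ascent. For the peak at block $T_{i_r}^{m_r}$ it is the segment from $(2i_r-2,0)$ to $(i_r+m_r,m_r-i_r+2)$. A block is on an extended ascent if its upper-left edge lies on it; thus the blocks on the extended ascents of $D$ are exactly the $T_{i_r}^{j}$ with $1\le r\le\ell$ and $i_r\le j\le m_r$. Subpaths. For a block $T_i^j$ on an extended ascent of $D$, the path $P_D(i,j)$ is drawn as follows: (1) start on the $x$-axis at $(2i-2,0)$ and rise past the blocks $T_i^i,T_i^{i+1},\dots$ up to the top vertex $(i+j,j-i+2)$ of the block $T_i^j$; (2) from there, descend by falls until the path hits another extended ascent of $D$ or returns to the $x$-axis; (3) if it hits an extended ascent (at a point not on the $x$-axis), take one rise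 step and go back to (2); (4) when the path returns to the $x$-axis, it is complete. Define $$p_D(i,j):=(\text{number of rise steps in } P_D(i,j))-1.$$ *)

(* Defs.v *)
From HB Require Import structures.
From mathcomp Require Import all_boot all_order all_algebra.
From mathcomp Require Import zify.

Set Implicit Arguments.
Unset Strict Implicit.
Unset Printing Implicit Defensive.

Import GRing.Theory.

(* * Words and commutation classes

   The simple root alpha_i of type A_n is represented by its label i : nat,
   1 <= i <= n.  A positive root-lattice element alpha = \sum_i c_i alpha_i is
   represented by any word [al] in which each label i occurs c_i times, and
   I^alpha is then the finite type of all rearrangements of [al].  Positions
   in words are counted from 0. *)

Notation word := (seq nat).

Definition Ialpha (al : word) : finType := seq_sub (permutations al).

(* The transposition s_r, exchanging the letters at positions r and r.+1
   (the identity if there is no position r.+1). *)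
Definition swap (r : nat) (w : word) : word :=
  take r w ++ (if drop r w is a :: b :: t then b :: a :: t else drop r w).

Definition adjacent (a b : nat) : bool := (a == b.+1) || (b == a.+1).
Definition distant (a b : nat) : bool := (a.+1 < b) || (b.+1 < a).

Lemma perm_swap r w : perm_eq (swap r w) w.
Proof.
have E := cat_take_drop r w; rewrite -[X in perm_eq _ X]E /swap perm_cat2l.
case: (drop r w) => [|a [|b t]] //=.
by rewrite -[b :: a :: t]/([:: b] ++ [:: a] ++ t) perm_catCA.
Qed.

Lemma swap_proof al r (w : Ialpha al) : swap r (ssval w) \in permutations al.
Proof.
have := ssvalP w; rewrite !mem_permutations.
exact: perm_trans (perm_swap r _).
Qed.

Definition swapI al (r : nat) (w : Ialpha al) : Ialpha al :=
  SeqSub (swap_proof r w).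

Definition letter al (w : Ialpha al) (r : nat) : nat := nth 0 (ssval w) r.

Definition commutation_step al (w w' : Ialpha al) : bool :=
  [exists r : 'I_(size al), [&& r.+1 < size al,
    distant (letter w r) (letter w r.+1) & w' == swapI r w]].

Definition commutation_class al (w : Ialpha al) : {set Ialpha al} :=
  [set w' | connect (@commutation_step al) w w'].

(* No word of the class contains a factor "aa" or "aba" with |a - b| = 1, i.e.
   the class consists of the reduced words of a fully commutative element. *)
Definition homogeneous al (C : {set Ialpha al}) : Prop :=
  (exists w, C = commutation_class w) /\
  (forall (w : Ialpha al) (r : nat), w \in C ->
     (r.+1 < size al -> letter w r <> letter w r.+1) /\
     (r.+2 < size al -> ~ (letter w r = letter w r.+2 /\
                           adjacent (letter w r) (letter w r.+1)))).

Record homogeneous_component (al : word) := HomogeneousComponent {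
  hcomp_set :> {set Ialpha al};
  hcompP : homogeneous hcomp_set }.

(* * Modules over the KLR algebra R_alpha of type A_n

   R_alpha is given by generators e(w), y_r, psi_r and relations, so that a
   (finite-dimensional) R_alpha-module is a vector space with linear operators
   satisfying these relations.  The polynomials are
   Q_{a,b}(u,v) = 0 if a = b, 1 if |a - b| > 1, u - v if b = a + 1, and
   v - u if a = b + 1.  Only the y_r with r < size al and the psi_r with
   r.+1 < size al are generators; the relations involve no others. *)

Section KLR.
Local Open Scope ring_scope.

Record klr_module (F : fieldType) (al : word) := KLRModule {
  klr_space :> vectType F;
  klr_e : Ialpha al -> {linear klr_space -> klr_space};
  klr_y : nat -> {linear klr_space -> klr_space};
  klr_psi : nat -> {linear klr_space -> klr_space};
  klr_e_orthogonal : forall w w' v,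
    klr_e w (klr_e w' v) = if w == w' then klr_e w v else 0;
  klr_e_sum : forall v, \sum_(w : Ialpha al) klr_e w v = v;
  klr_y_e : forall r w v, (r < size al)%N ->
    klr_y r (klr_e w v) = klr_e w (klr_y r v);
  klr_psi_e : forall r w v, (r.+1 < size al)%N ->
    klr_psi r (klr_e w v) = klr_e (swapI r w) (klr_psi r v);
  klr_y_y : forall r s v, (r < size al)%N -> (s < size al)%N ->
    klr_y r (klr_y s v) = klr_y s (klr_y r v);
  klr_psi_y : forall r s v, (r.+1 < size al)%N -> (s < size al)%N ->
    s != r -> s != r.+1 -> klr_psi r (klr_y s v) = klr_y s (klr_psi r v);
  klr_psi_psi : forall r s v, (r.+1 < s)%N -> (s.+1 < size al)%N ->
    klr_psi r (klr_psi s v) = klr_psi s (klr_psi r v);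
  klr_psi_yS : forall r w v, (r.+1 < size al)%N ->
    klr_psi r (klr_y r.+1 (klr_e w v)) =
      klr_y r (klr_psi r (klr_e w v)) +
      (if letter w r == letter w r.+1 then klr_e w v else 0);
  klr_yS_psi : forall r w v, (r.+1 < size al)%N ->
    klr_y r.+1 (klr_psi r (klr_e w v)) =
      klr_psi r (klr_y r (klr_e w v)) +
      (if letter w r == letter w r.+1 then klr_e w v else 0);
  klr_psi_sqr : forall r w v, (r.+1 < size al)%N ->
    klr_psi r (klr_psi r (klr_e w v)) =
      if letter w r == letter w r.+1 then 0
      else if letter w r.+1 == (letter w r).+1 then
        klr_y r (klr_e w v) - klr_y r.+1 (klr_e w v)
      else if letter w r == (letter w r.+1).+1 then
        klr_y r.+1 (klr_e w v) - klr_y r (klr_e w v)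
      else klr_e w v;
  klr_braid : forall r w v, (r.+2 < size al)%N ->
    klr_psi r.+1 (klr_psi r (klr_psi r.+1 (klr_e w v))) -
    klr_psi r (klr_psi r.+1 (klr_psi r (klr_e w v))) =
      if letter w r == letter w r.+2 then
        if letter w r.+1 == (letter w r).+1 then klr_e w v
        else if letter w r == (letter w r.+1).+1 then - klr_e w v
        else 0
      else 0 }.

End KLR.

(* * Homogeneous modules *)

Section HomogeneousModule.
Local Open Scope ring_scope.

Variables (F : fieldType) (al : word).

Section Operators.
Variable C : {set Ialpha al}.

Local Notation hspace := {ffun {w : Ialpha al | w \in C} -> F^o}.

Lemma hspaceP (f g : hspace) : (forall u, f u = g u) -> f = g.
Proof. by move=> fg; apply/(@ffunP _ (fun=> F^o)). Qed.

(* The basis vector v_w, extended by v_w = 0 for w not in C. *)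
Definition hvec (w : Ialpha al) : hspace := [ffun u => (val u == w)%:R].

(* The linear operator with v_w |-> g w for w in C. *)
Definition hlin (g : Ialpha al -> hspace) (f : hspace) : hspace :=
  \sum_u f u *: g (val u).

Lemma hlin_linear g : linear (hlin g).
Proof.
move=> a x y; rewrite /hlin scaler_sumr -big_split /=; apply: eq_bigr => u _.
by rewrite !ffunE scalerDl scalerA.
Qed.
HB.instance Definition _ g :=
  GRing.isLinear.Build F hspace hspace *:%R (hlin g) (hlin_linear g).

Definition he (w' : Ialpha al) : {linear hspace -> hspace} :=
  hlin (fun w => if w == w' then hvec w else 0).
Definition hy (r : nat) : {linear hspace -> hspace} := hlin (fun=> 0).
Definition hpsi (r : nat) : {linear hspace -> hspace} :=
  hlin (fun w => if swapI r w \in C then hvec (swapI r w) else 0).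

Lemma hvec0 w : w \notin C -> hvec w = 0.
Proof.
move=> wC; refine (hspaceP _) => u; rewrite !ffunE.
by case: eqP => // uw; move: wC; rewrite -uw (valP u).
Qed.

Lemma hlin_vec g w : w \in C -> hlin g (hvec w) = g w.
Proof.
move=> wC; rewrite /hlin (bigD1 (exist _ w wC)) //= ffunE eqxx scale1r.
rewrite big1 ?addr0 // => u; rewrite -val_eqE /= => /negPf uw.
by rewrite ffunE uw scale0r.
Qed.

Lemma hvec_decomp (f : hspace) : f = \sum_u f u *: hvec (val u).
Proof.
refine (hspaceP _) => t; rewrite sum_ffunE (bigD1 t) //= !ffunE eqxx.
rewrite big1 ?addr0; first by rewrite /GRing.scale /= mulr1.
move=> u; rewrite -val_eqE /= eq_sym => /negPf uw.
by rewrite !ffunE uw scaler0.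
Qed.

Lemma hext (f g : {linear hspace -> hspace}) :
  (forall w, w \in C -> f (hvec w) = g (hvec w)) -> f =1 g.
Proof.
move=> fg v; rewrite (hvec_decomp v) !linear_sum; apply: eq_bigr => u _.
by rewrite !linearZ /= fg // (valP u).
Qed.

End Operators.
End HomogeneousModule.

Lemma size_swap r w : size (swap r w) = size w.
Proof. exact/perm_size/perm_swap. Qed.

Lemma swapK r : involutive (swap r).
Proof.
move=> w; have E := cat_take_drop r w; case D: (drop r w) => [|a t].
  have sw : swap r w = w by rewrite /swap D -[RHS]E D.
  by rewrite !sw.
have st : size (take r w) = r.
  by rewrite size_take ifT // ltnNge; apply/negP=> /drop_oversize; rewrite D.
have D' : drop r (swap r w) = if t is b :: t' then b :: a :: t' else a :: t.
  by rewrite /swap drop_size_cat // D; case: (t).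
rewrite {1}/swap D' /swap take_size_cat // -[RHS]E D.
by case: (t).
Qed.

Lemma drop_nth2 r (w : word) : r.+1 < size w ->
  w = take r w ++ [:: nth 0 w r, nth 0 w r.+1 & drop r.+2 w].
Proof.
by move=> rw; rewrite -!drop_nth ?cat_take_drop //; apply: ltnW.
Qed.

Lemma swapE r (w : word) : r.+1 < size w ->
  swap r w = take r w ++ [:: nth 0 w r.+1, nth 0 w r & drop r.+2 w].
Proof.
by move=> rw; rewrite /swap (drop_nth 0) ?(drop_nth 0 (n := r.+1)) //; apply: ltnW.
Qed.

Lemma nth_swap r (w : word) i : r.+1 < size w ->
  nth 0 (swap r w) i =
    nth 0 w (if i == r then r.+1 else if i == r.+1 then r else i).
Proof.
move=> rw; rewrite swapE //.
have st : size (take r w) = r by rewrite size_take; case: ltnP => //; lia.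
rewrite nth_cat st; case: (ltnP i r) => ir.
  by rewrite nth_take // !ifF //; apply/eqP; lia.
case: (eqVneq i r) => [->|n1]; first by rewrite subnn.
case: (eqVneq i r.+1) => [->|n2]; first by rewrite subSnn.
have -> : i - r = (i - r.+2).+2 by lia.
by rewrite /= nth_drop; congr (nth _ _ _); lia.
Qed.

Lemma size_Ialpha al (w : Ialpha al) : size (ssval w) = size al.
Proof. by have := ssvalP w; rewrite mem_permutations => /perm_size. Qed.

Lemma Ialpha_eq al (w w' : Ialpha al) : ssval w = ssval w' -> w = w'.
Proof. by move=> E; apply: val_inj. Qed.

Lemma swapIK al r : involutive (@swapI al r).
Proof. by move=> w; apply: Ialpha_eq; rewrite /= swapK. Qed.

Lemma letter_swap al r (w : Ialpha al) i : r.+1 < size al ->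
  letter (swapI r w) i =
    letter w (if i == r then r.+1 else if i == r.+1 then r else i).
Proof. by move=> rw; rewrite /letter /= nth_swap ?size_Ialpha. Qed.

Lemma Ialpha_letterP al (w w' : Ialpha al) :
  (forall i, letter w i = letter w' i) -> w = w'.
Proof.
move=> ww'; apply: Ialpha_eq; apply: (@eq_from_nth _ 0); first by rewrite !size_Ialpha.
by move=> i _; apply: ww'.
Qed.

Definition two_letters (a : nat) : pred nat := [pred x | (x == a) || (x == a.+1)].

Lemma filter_commutation al a (w w' : Ialpha al) :
  w' \in commutation_class w ->
  filter (two_letters a) (ssval w') = filter (two_letters a) (ssval w).
Proof.
rewrite inE => /connectP [p]; elim: p w => [|u p IH] w /=; first by move=> _ ->.
case/andP=> /existsP [r /and3P [rs dist /eqP uE]] pu w'E.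
rewrite (IH u pu w'E) uE /= swapE ?size_Ialpha //.
rewrite [in RHS](@drop_nth2 r (ssval w)) ?size_Ialpha // !filter_cat /=.
congr cat; move: dist; rewrite /letter /distant.
case E1 : (two_letters a _) => //; case E2 : (two_letters a _) => //.
by move: E1 E2; rewrite /two_letters /=; lia.
Qed.

Lemma class_swap al (w u : Ialpha al) r :
  u \in commutation_class w -> r.+1 < size al ->
  distant (letter u r) (letter u r.+1) -> swapI r u \in commutation_class w.
Proof.
rewrite !inE => wu rs d; apply: connect_trans wu _; apply: connect1.
by apply/existsP; exists (Ordinal (ltnW rs)); rewrite /= rs d eqxx.
Qed.

Lemma homogeneous_swap al (C : homogeneous_component al) w r :
  w \in hcomp_set C -> r.+1 < size al ->
  (swapI r w \in hcomp_set C) = distant (letter w r) (letter w r.+1).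
Proof.
case: C => C [[w0 CE] hC] /= wC rs; apply/idP/idP => [sC|]; last first.
  by rewrite CE in wC *; apply: class_swap.
have [/(_ rs) neq _] := hC _ r wC.
case adj : (adjacent (letter w r) (letter w r.+1)); last first.
  by move: adj neq; rewrite /adjacent /distant; lia.
rewrite CE in wC sC.
have := filter_commutation (minn (letter w r) (letter w r.+1)) sC.
rewrite -(filter_commutation _ wC) /= swapE ?size_Ialpha //.
rewrite [in RHS](@drop_nth2 r (ssval w)) ?size_Ialpha // !filter_cat /=.
move=> /eqP; rewrite eqseq_cat // eqxx /=.
have -> : two_letters (minn (letter w r) (letter w r.+1)) (nth 0 (ssval w) r).
  by move: adj; rewrite /adjacent /letter /two_letters /=; lia.
have -> : two_letters (minn (letter w r) (letter w r.+1)) (nth 0 (ssval w) r.+1).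
  by move: adj; rewrite /adjacent /letter /two_letters /=; lia.
by rewrite eqseq_cons => /andP [/eqP E _]; case: neq.
Qed.
Section HomogeneousModuleRelations.
Local Open Scope ring_scope.

Variables (F : fieldType) (al : word) (C : homogeneous_component al).

Local Notation v_ := (@hvec F al C).
Local Notation e := (@he F al C).
Local Notation y := (@hy F al C).
Local Notation psi := (@hpsi F al C).

Lemma he_scale w (v : {ffun {w : Ialpha al | w \in hcomp_set C} -> F^o}) :
  exists2 c : F, e w v = c *: v_ w & w \in hcomp_set C \/ c = 0.
Proof.
case: (boolP (w \in hcomp_set C)) => wC; last first.
  exists 0; last by right.
  rewrite scale0r /he /= /hlin big1 // => u _; rewrite ifF ?scaler0 //.
  by apply: contraNF wC => /eqP <-; apply: (valP u).
exists (v (exist _ w wC)); last by left.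
rewrite /he /= /hlin (bigD1 (exist _ w wC)) //= eqxx big1 ?addr0 // => u.
by rewrite -val_eqE /= => /negPf ->; rewrite scaler0.
Qed.

Lemma he_vec w w' : e w (v_ w') = if w' == w then v_ w else 0.
Proof.
case: (boolP (w' \in hcomp_set C)) => w'C.
  by rewrite /he /= hlin_vec //; case: eqP => [->|].
rewrite (hvec0 F w'C) linear0; case: eqP => // E.
by rewrite -E hvec0.
Qed.

Lemma hy0 r v : y r v = 0.
Proof. by rewrite /hy /= /hlin big1 // => u _; rewrite scaler0. Qed.

Lemma hpsi_vec r w : (r.+1 < size al)%N -> w \in hcomp_set C ->
  psi r (v_ w) = if distant (letter w r) (letter w r.+1)
                 then v_ (swapI r w) else 0.
Proof. by move=> rs wC; rewrite /hpsi /= hlin_vec // homogeneous_swap. Qed.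

Lemma homog_mem_swap r w : (r.+1 < size al)%N -> w \in hcomp_set C ->
  distant (letter w r) (letter w r.+1) -> swapI r w \in hcomp_set C.
Proof. by move=> rs wC; rewrite homogeneous_swap. Qed.

Lemma homog_letter1 r w : (r.+1 < size al)%N -> w \in hcomp_set C ->
  (letter w r == letter w r.+1) = false.
Proof. by move=> rs wC; have [/(_ rs) /eqP/negPf] := (hcompP C).2 w r wC. Qed.

Lemma he_orthogonal w w' v : e w (e w' v) = if w == w' then e w v else 0.
Proof.
have [c E _] := he_scale w' v; rewrite E linearZ /= he_vec eq_sym.
by case: eqP => [->|_]; [rewrite E | rewrite scaler0].
Qed.

Lemma he_sum v : \sum_w e w v = v.
Proof.
have E w : e w v = \sum_u e w (v u *: v_ (val u)).
  by rewrite -linear_sum -hvec_decomp.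
rewrite (eq_bigr _ (fun w _ => E w)).
rewrite [RHS]hvec_decomp exchange_big; apply: eq_bigr => u _ /=.
rewrite (bigD1 (val u)) //= big1 ?addr0 => [|w wu]; rewrite linearZ he_vec /=.
  by rewrite eqxx.
rewrite ifF /= ?scaler0 //; apply/eqP => E'; by rewrite -E' eqxx in wu.
Qed.

Lemma hpsi_e r w v : (r.+1 < size al)%N ->
  psi r (e w v) = e (swapI r w) (psi r v).
Proof.
move=> rs; apply: (@hext F al C (psi r \o e w) (e (swapI r w) \o psi r)).
move=> u uC /=; rewrite he_vec; case: eqP => [uw|uw].
  rewrite -uw hpsi_vec //.
  by case: ifP => _; rewrite ?linear0 // he_vec eqxx.
rewrite linear0 hpsi_vec //; case: ifP => _; rewrite ?linear0 // he_vec.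
by rewrite (inj_eq (can_inj (@swapIK al r))); move/eqP/negPf: uw => ->.
Qed.

Lemma hpsi_psi r s v : (r.+1 < s)%N -> (s.+1 < size al)%N ->
  psi r (psi s v) = psi s (psi r v).
Proof.
move=> rs ss; have rs' : (r.+1 < size al)%N by lia.
apply: (@hext F al C (psi r \o psi s) (psi s \o psi r)).
move=> u uC /=; rewrite !hpsi_vec //.
have L t i : (t.+1 < size al)%N -> i != t -> i != t.+1 ->
    letter (swapI t u) i = letter u i.
  by move=> ts /negPf it /negPf itS; rewrite letter_swap // it itS.
have sw : swapI r (swapI s u) = swapI s (swapI r u).
  apply: Ialpha_letterP => i; rewrite !letter_swap //; congr letter.
  by case: (i =P r) => ?; case: (i =P r.+1) => ?; case: (i =P s) => ?;
    case: (i =P s.+1) => ?; repeat (case: eqP => ?); lia.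
case ds: (distant (letter u s) _); case dr: (distant (letter u r) _);
  rewrite ?linear0 // hpsi_vec ?homog_mem_swap // !L ?ds ?dr ?sw //; try lia.
- by rewrite hpsi_vec ?homog_mem_swap // !L ?ds //; lia.
Qed.

Lemma hpsi_sqr r w v : (r.+1 < size al)%N ->
  psi r (psi r (e w v)) =
    if letter w r == letter w r.+1 then 0
    else if letter w r.+1 == (letter w r).+1 then
      y r (e w v) - y r.+1 (e w v)
    else if letter w r == (letter w r.+1).+1 then
      y r.+1 (e w v) - y r (e w v)
    else e w v.
Proof.
move=> rs; rewrite !hy0 subrr.
have [c -> [wC|->]] := he_scale w v; last first.
  by rewrite scale0r !linear0 !if_same.
rewrite homog_letter1 // !linearZ /= hpsi_vec //.
have := homog_letter1 rs wC; have := homog_mem_swap rs wC.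
case d: (distant _ _) => swC neq; first have {}swC := swC isT.
  rewrite hpsi_vec // !letter_swap // eqxx.
  rewrite (negPf (_ : r.+1 != r)) ?eqxx ?swapIK; last by lia.
  by move: d; rewrite /distant orbC => d; rewrite d !ifF //; move: d; lia.
rewrite linear0 scaler0; case: ifP => // n1; case: ifP => // n2.
by move: d neq n1 n2; rewrite /distant; lia.
Qed.

Lemma hbraid r w v : (r.+2 < size al)%N ->
  psi r.+1 (psi r (psi r.+1 (e w v))) - psi r (psi r.+1 (psi r (e w v))) =
    if letter w r == letter w r.+2 then
      if letter w r.+1 == (letter w r).+1 then e w v
      else if letter w r == (letter w r.+1).+1 then - e w v
      else 0
    else 0.
Proof.
move=> rs; have rs' : (r.+1 < size al)%N by apply: ltnW.
have [c -> [wC|->]] := he_scale w v; last first.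
  by rewrite scale0r !linear0 addr0 !if_same.
have [_ hom] := (hcompP C).2 w r wC; have {}hom := hom rs.
transitivity (0 : {ffun {w : Ialpha al | w \in hcomp_set C} -> F^o}); last first.
  case: eqP => // E; rewrite !ifF //; apply/negP=> /eqP E';
    by case: hom; split=> //; rewrite /adjacent E' eqxx ?orbT.
have L : forall (u : Ialpha al) (i : nat), (letter (swapI r u) i = letter u
    (if i == r then r.+1 else if i == r.+1 then r else i))
  by move=> u i; rewrite letter_swap.
have LS : forall (u : Ialpha al) (i : nat), (letter (swapI r.+1 u) i = letter u
    (if i == r.+1 then r.+2 else if i == r.+2 then r.+1 else i))
  by move=> u i; rewrite letter_swap.
have f1 : (r == r.+1) = false by lia.
have f2 : (r.+1 == r) = false by lia.
have f3 : (r.+2 == r) = false by lia.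
have f4 : (r.+2 == r.+1) = false by lia.
have f5 : (r.+1 == r.+2) = false by lia.
have f6 : (r == r.+2) = false by lia.
have EL := (L, LS, f1, f2, f3, f4, f5, f6, eqxx).
have sw : swapI r.+1 (swapI r (swapI r.+1 w)) = swapI r (swapI r.+1 (swapI r w)).
  apply: Ialpha_letterP => i; rewrite !letter_swap //; congr letter.
  case: (i =P r) => [E|/eqP/negPf i0]; rewrite ?E; do 4 rewrite ?EL /= //.
  case: (i =P r.+1) => [E|/eqP/negPf i1]; rewrite ?E; do 4 rewrite ?EL /= //.
  by case: (i =P r.+2) => [E|/eqP/negPf i2]; rewrite ?E; do 4 rewrite ?EL ?i0 ?i1 ?i2 /= //.
rewrite !linearZ /= -scalerDr !hpsi_vec //.
have M1 := homog_mem_swap rs' wC; have M2 := homog_mem_swap rs wC.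
case d12: (distant (letter w r) (letter w r.+1)) M1 => M1;
case d23: (distant (letter w r.+1) (letter w r.+2)) M2 => M2;
  rewrite ?linear0 ?addr0 ?scaler0 //.
- have M1' := M1 isT; have M2' := M2 isT.
  have := homog_mem_swap rs M1'; have := homog_mem_swap rs' M2'.
  rewrite !hpsi_vec // !EL; case d13: (distant (letter w r) (letter w r.+2)).
    move=> /(_ isT) N1 /(_ isT) N2.
    by rewrite !hpsi_vec // !EL d12 d23 sw subrr scaler0.
  by rewrite !linear0 ?addr0 ?scaler0.
- have M1' := M1 isT; have := homog_mem_swap rs M1'.
  rewrite hpsi_vec // !EL; case: (distant _ _) => N; last by rewrite !linear0 ?addr0 ?scaler0.
  by rewrite hpsi_vec ?N // !EL d23 ?linear0 ?addr0 ?scaler0.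
- have M2' := M2 isT; have := homog_mem_swap rs' M2'.
  rewrite hpsi_vec // !EL; case: (distant _ _) => N; last by rewrite !linear0 ?addr0 ?scaler0.
  by rewrite hpsi_vec ?N // !EL d12 ?linear0 ?addr0 ?scaler0.
Qed.

Lemma hpsi_yS r w v : (r.+1 < size al)%N ->
  psi r (y r.+1 (e w v)) =
    y r (psi r (e w v)) + (if letter w r == letter w r.+1 then e w v else 0).
Proof.
move=> rs; rewrite !hy0 linear0 add0r.
have [c -> [wC|->]] := he_scale w v; last by rewrite scale0r if_same.
by rewrite homog_letter1.
Qed.

Lemma hyS_psi r w v : (r.+1 < size al)%N ->
  y r.+1 (psi r (e w v)) =
    psi r (y r (e w v)) + (if letter w r == letter w r.+1 then e w v else 0).
Proof.
move=> rs; rewrite !hy0 linear0 add0r.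
have [c -> [wC|->]] := he_scale w v; last by rewrite scale0r if_same.
by rewrite homog_letter1.
Qed.

Lemma hy_e r w v : (r < size al)%N -> y r (e w v) = e w (y r v).
Proof. by rewrite !hy0 linear0. Qed.

Lemma hy_y r s v : (r < size al)%N -> (s < size al)%N ->
  y r (y s v) = y s (y r v).
Proof. by rewrite !hy0. Qed.

Lemma hpsi_y r s v : (r.+1 < size al)%N -> (s < size al)%N ->
  s != r -> s != r.+1 -> psi r (y s v) = y s (psi r v).
Proof. by rewrite !hy0 linear0. Qed.


(* The module S(C), with basis (v_w), w \in C. *)
Definition homogeneous_module : klr_module F al :=
  @KLRModule F al {ffun {w : Ialpha al | w \in hcomp_set C} -> F^o} e y psi
    he_orthogonal he_sum hy_e hpsi_e hy_y hpsi_y hpsi_psi hpsi_yS hyS_psi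
    hpsi_sqr hbraid.

End HomogeneousModuleRelations.

(* * Dyck paths

   A path is a sequence of steps, true being a rise and false a fall; after k
   steps it is at the point (k, height D k). *)

Definition rises (D : seq bool) (k : nat) : nat := count_mem true (take k D).
Definition falls (D : seq bool) (k : nat) : nat := count_mem false (take k D).
Definition height (D : seq bool) (k : nat) : nat := rises D k - falls D k.

Definition dyck_path (m : nat) (D : seq bool) : Prop :=
  [/\ size D = m.*2, rises D m.*2 = m & forall k, falls D k <= rises D k].

Record dyck (m : nat) := Dyck { steps :> seq bool; dyckP : dyck_path m steps }.

(* The x-coordinates of the peaks, from left to right. *)
Definition peaks (D : seq bool) : seq nat :=
  [seq k <- iota 1 (size D).-1 | nth false D k.-1 && ~~ nth true D k].

(* The steps a, ..., a + l - 1 of D form an ascent, which thus begins at the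
   point (a, height D a). *)
Definition is_ascent (D : seq bool) (a l : nat) : Prop :=
  [/\ 0 < l, a + l <= size D, forall t, a <= t < a + l -> nth false D t,
      a = 0 \/ nth true D a.-1 = false & nth false D (a + l) = false].

(* * Blocks

   The pair (i, j) stands for the block T_i^j, 1 <= i <= j <= n. *)

Definition blocks (n : nat) : seq (nat * nat) :=
  [seq (i, j) | i <- iota 1 n, j <- iota i (n.+1 - i)].

Definition block_word (b : nat * nat) : word := rev (iota b.1 (b.2.+1 - b.1)).

Definition block_top (b : nat * nat) : nat * nat :=
  (b.1 + b.2, b.2 - b.1 + 2).
Definition block_left (b : nat * nat) : nat * nat :=
  (b.1 + b.2 - 1, b.2 - b.1 + 1).

(* A peak of height 1 is at the top of no block, and one of height >= 2 at the
   top of exactly one. *)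
Definition peak_blocks (n : nat) (D : seq bool) : seq (nat * nat) :=
  flatten [seq [seq b <- blocks n | block_top b == (k, height D k)]
          | k <- peaks D].

Definition psi_word (n : nat) (D : seq bool) : word :=
  flatten [seq block_word b | b <- peak_blocks n D].

Lemma psi_word_perm n D : psi_word n D \in permutations (psi_word n D).
Proof. by rewrite mem_permutations. Qed.

Definition psi_Ialpha n D : Ialpha (psi_word n D) := SeqSub (psi_word_perm n D).

Lemma mem_blocks n b : (b \in blocks n) = [&& 0 < b.1, b.1 <= b.2 & b.2 <= n].
Proof.
case: b => i j /=; apply/allpairsPdep/and3P => /=.
  by case=> i' [j' [+ + [-> ->]]]; rewrite !mem_iota => ? ?; split; lia.
by case=> *; exists i, j; split=> //; rewrite mem_iota; lia.
Qed.

Lemma uniq_blocks n : uniq (blocks n).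
Proof.
by apply: allpairs_uniq_dep => [|i _|[i j] [i' j'] _ _ /= [-> ->]];
  rewrite ?iota_uniq.
Qed.

Lemma rises_falls D k : k <= size D -> rises D k + falls D k = k.
Proof.
move=> kD; rewrite /rises /falls -[RHS](size_takel kD) -(count_predC (pred1 true)).
by congr addn; apply: eq_count => -[].
Qed.

Lemma mem_peaks D k : k \in peaks D ->
  [/\ 0 < k, k < size D, nth false D k.-1 & ~~ nth true D k].
Proof. by rewrite mem_filter mem_iota => /andP [/andP [-> ->]] ?; split=> //; lia. Qed.

Lemma peak_block m (D : dyck m) n k b : k \in peaks D -> b \in blocks n ->
  (block_top b == (k, height D k)) = (b == ((falls D k).+1, (rises D k).-1)).
Proof.
case/mem_peaks => k0 kD _ _; have := rises_falls (ltnW kD).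
have [_ _ /(_ k)] := dyckP D; rewrite mem_blocks /height.
case: b => i j /= fr rfk /and3P [i0 ij jn]; rewrite /block_top /= !xpair_eqE.
by apply/andP/andP => -[/eqP e1 /eqP e2]; split; apply/eqP; lia.
Qed.

Lemma peak_mono (D : seq bool) k k' : k \in peaks D -> k' \in peaks D -> k < k' ->
  falls D k < falls D k' /\ rises D k < rises D k'.
Proof.
move=> /mem_peaks [k0 kD _ fk] /mem_peaks [k0' kD' rk' _] kk'.
have S c t : t < size D -> count_mem c (take t.+1 D) =
    count_mem c (take t D) + (nth false D t == c).
  by move=> tD; rewrite (take_nth false) // -cats1 count_cat /= addn0.
have M c t t' : t <= t' -> count_mem c (take t D) <= count_mem c (take t' D).
  move=> tt'; rewrite -[in leqRHS](cat_take_drop t (take t' D)) take_takel //.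
  by rewrite count_cat leq_addr.
have {}fk : nth false D k = false.
  by rewrite (set_nth_default true) //; apply: negbTE.
rewrite /falls /rises; split.
  by apply: leq_trans (M false k.+1 k' kk'); rewrite S // fk addn1.
have k'E : k' = k'.-1.+1 by lia.
have kk'' : k <= k'.-1 by lia.
rewrite k'E S ?rk' ?addn1 ?ltnS; first exact: M.
by lia.
Qed.

Definition block_lt (b b' : nat * nat) : bool := (b.1 < b'.1) && (b.2 < b'.2).

Lemma pairwise_peak_blocks n m (D : dyck m) : pairwise block_lt (peak_blocks n D).
Proof.
have pE k : k \in peaks D -> exists2 s,
    [seq b <- blocks n | block_top b == (k, height D k)] = s &
    s = [::] \/ s = [:: ((falls D k).+1, (rises D k).-1)].
  move=> kD; eexists; first by [].
  rewrite (eq_in_filter (a2 := pred1 ((falls D k).+1, (rises D k).-1))).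
    case: (boolP (((falls D k).+1, (rises D k).-1) \in blocks n)) => h.
      by right; rewrite filter_pred1_uniq ?uniq_blocks.
    left; apply/eqP; rewrite -[_ == _]negbK -has_filter; apply/hasPn => b bn.
    by apply: contraNneq h => <-.
  by move=> b bn; rewrite /= (peak_block kD bn).
have srt : pairwise ltn (peaks D).
  by apply: pairwise_filter; rewrite -(sorted_pairwise ltn_trans) iota_ltn_sorted.
rewrite /peak_blocks.
have sub : {subset peaks D <= peaks D} by [].
suff: forall ks, pairwise ltn ks -> {subset ks <= peaks D} ->
    pairwise block_lt (flatten [seq [seq b <- blocks n |
      block_top b == (k, height D k)] | k <- ks]) by apply.
elim=> //= k ks IH /andP [kks kss] kD_.
rewrite pairwise_cat IH // ?andbT; last by move=> x xks; rewrite kD_ // inE xks orbT.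
have kD : k \in peaks D by rewrite kD_ // mem_head.
have [s -> sE] := pE k kD; apply/andP; split; last by case: sE => ->.
apply/allrelP => b b' bs /flatten_mapP [k' k'ks].
have k'D : k' \in peaks D by rewrite kD_ // inE k'ks orbT.
have [s' -> sE'] := pE k' k'D.
have [] := peak_mono kD k'D (allP kks _ k'ks) => ? ?.
case: sE bs => -> //; case: sE' => -> //; rewrite !inE => /eqP -> /eqP ->.
have /mem_peaks [k0 kn _ _] := kD; have := rises_falls (ltnW kn).
by have [_ _ /(_ k)] := dyckP D; rewrite /block_lt /=; lia.
Qed.

Section Alternation.
Variable a : nat.

Local Notation F := (filter (two_letters a)).

Lemma filter_block_word b : F (block_word b) =
  (if b.1 <= a.+1 <= b.2 then [:: a.+1] else [::]) ++
  (if b.1 <= a <= b.2 then [:: a] else [::]).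
Proof.
have gen i k : F (rev (iota i k)) =
    (if i <= a.+1 < i + k then [:: a.+1] else [::]) ++
    (if i <= a < i + k then [:: a] else [::]).
  elim: k => [|k IH]; first by rewrite !ifF //; lia.
  rewrite -addn1 iotaD rev_cat /= IH /two_letters /=.
  case: (i + k =P a) => h1; last case: (i + k =P a.+1) => h2 /=.
  - have -> : (i <= a.+1 < i + (k + 1)) = false by lia.
    have -> : (i <= a.+1 < i + k) = false by lia.
    have -> : (i <= a < i + (k + 1)) = true by lia.
    have -> : (i <= a < i + k) = false by lia.
    by rewrite h1.
  - have -> : (i <= a.+1 < i + (k + 1)) = true by lia.
    have -> : (i <= a.+1 < i + k) = false by lia.
    have -> : (i <= a < i + (k + 1)) = (i <= a < i + k) by lia.
    by rewrite h2.
  - have -> : (i <= a.+1 < i + (k + 1)) = (i <= a.+1 < i + k) by lia.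
    by have -> : (i <= a < i + (k + 1)) = (i <= a < i + k) by lia.
rewrite /block_word gen; case: b => i m /=.
have -> : (i <= a.+1 <= m) = (i <= a.+1 < i + (m.+1 - i)) by lia.
by have -> : (i <= a <= m) = (i <= a < i + (m.+1 - i)) by lia.
Qed.

Lemma filter_blocks_high bs : all (fun b => a < b.2) bs ->
  head a.+1 (F (flatten [seq block_word b | b <- bs])) = a.+1.
Proof.
elim: bs => //= b bs IH /andP [ab /IH {}IH]; rewrite filter_cat filter_block_word ab.
by case: (leqP b.1 a) => ba; [have -> : b.1 <= a.+1 by lia | case: ifP].
Qed.

Lemma filter_blocks_out bs : all (fun b => a.+1 < b.1) bs ->
  F (flatten [seq block_word b | b <- bs]) = [::].
Proof.
elim: bs => //= b bs IH /andP [ab /IH {}IH]; rewrite filter_cat filter_block_word IH.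
by rewrite !ifF //; lia.
Qed.

Lemma blocks_alternate bs : pairwise block_lt bs ->
  sorted (fun x y => x != y) (F (flatten [seq block_word b | b <- bs])).
Proof.
elim: bs => //= b bs IH /andP [lt_b /IH {}IH]; rewrite filter_cat filter_block_word.
have nSa : a.+1 != a by lia.
have nSa' : a != a.+1 by lia.
case: ifP => h1; case: ifP => h2 //=.
- have H := @filter_blocks_high bs.
  move: IH H; case: (F _) => [|c s] /=; first by rewrite nSa.
  move=> -> ->; first by rewrite nSa nSa'.
  by apply: sub_all lt_b => b' /andP [_]; lia.
- rewrite filter_blocks_out //.
  by apply: sub_all lt_b => b' /andP [+ _]; lia.
- have H := @filter_blocks_high bs.
  move: IH H; case: (F _) => [|c s] //=.
  move=> -> ->; first by rewrite nSa'.
  by apply: sub_all lt_b => b' /andP [_]; lia.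
Qed.
End Alternation.

Lemma alternate_factor a (w : word) s1 s2 x :
  sorted (fun x y => x != y) (filter (two_letters a) w) ->
  filter (two_letters a) w <> s1 ++ [:: x, x & s2].
Proof. by move=> + E; rewrite E => /cat_sorted2 [_ /=]; rewrite eqxx. Qed.

Lemma psi_homogeneous n m (D : dyck m) :
  homogeneous (commutation_class (psi_Ialpha n D)).
Proof.
have pos : all (leq 1) (psi_word n D).
  apply/allP => x /flatten_mapP [b /flatten_mapP [k _]].
  rewrite mem_filter mem_blocks mem_rev mem_iota => /andP [_ /and3P [b0 _ _]].
  by case/andP=> + _; apply: leq_trans.
have alt a := @blocks_alternate a _ (@pairwise_peak_blocks n m D).
split; first by exists (psi_Ialpha n D).
move=> w r wC; split=> [rs E|rs [E adj]].
  apply: (@alternate_factor (letter w r) _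
    (filter (two_letters (letter w r)) (take r (ssval w)))
    (filter (two_letters (letter w r)) (drop r.+2 (ssval w))) (letter w r)
    (alt (letter w r))).
  rewrite -(filter_commutation _ wC).
  rewrite [in LHS](@drop_nth2 r (ssval w)) ?size_Ialpha // filter_cat /=.
  by rewrite -!/(letter w _) -E /two_letters /= eqxx.
set a := if letter w r == (letter w r.+1).+1 then letter w r else (letter w r).-1.
have x0 : 0 < letter w r.
  have : all (leq 1) (ssval w).
    by rewrite (perm_all _ (_ : perm_eq _ (psi_word n D))) // -mem_permutations ssvalP.
  by move/allP; apply; rewrite mem_nth // size_Ialpha; lia.
apply: (@alternate_factor a _
    (filter (two_letters a) (take r (ssval w)))
    (filter (two_letters a) (drop r.+3 (ssval w))) (letter w r) (alt a)).
rewrite -(filter_commutation _ wC).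
rewrite [in LHS](@drop_nth2 r (ssval w)) ?size_Ialpha; last by lia.
rewrite (drop_nth 0) ?size_Ialpha // filter_cat /= -!/(letter w _) -E.
have -> : two_letters a (letter w r).
  by rewrite /two_letters /=; move: @a; case: ifP => /= *; lia.
have -> // : two_letters a (letter w r.+1) = false.
by move: adj; rewrite /two_letters /adjacent /=; move: @a; case: ifP => /= *; lia.
Qed.

Definition Psi n (D : dyck n.+1) : homogeneous_component (psi_word n D) :=
  HomogeneousComponent (psi_homogeneous n D).

(* * Extended ascents and the paths P_D(i, j) *)

(* The point (x, y), with x and y natural numbers, lies on the segment of
   slope 1 from the x-axis to the peak (k, height D k). *)
Definition on_extended_ascent (D : seq bool) (k : nat) (pt : nat * nat) : bool :=
  (pt.1 + height D k == k + pt.2) && (pt.2 <= height D k).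

(* The blocks whose upper-left edge lies on an extended ascent. *)
Definition ascent_blocks (n : nat) (D : seq bool) : seq (nat * nat) :=
  [seq b <- blocks n | has (fun k => on_extended_ascent D k (block_left b) &&
                                     on_extended_ascent D k (block_top b))
                           (peaks D)].

(* The steps from (x, y) on, starting with a fall: after each fall, the path
   stops if it is on the x-axis, and takes one rise if it is on an extended
   ascent.  Each iteration moves to the right; by [subpath_complete], size D
   iterations always suffice to reach the x-axis. *)
Fixpoint descent (D : seq bool) (fuel x y : nat) : seq bool :=
  if fuel is fuel'.+1 then
    if y is y'.+1 then
      if (0 < y') && has (fun k => on_extended_ascent D k (x.+1, y')) (peaks D)
      then [:: false, true & descent D fuel' x.+2 y'.+1]
      else false :: descent D fuel' x.+1 y'
    else [::]
  else [::].

Definition subpath (D : seq bool) (i j : nat) : seq bool :=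
  let: (x, y) := block_top (i, j) in nseq y true ++ descent D (size D) x y.

Definition p_ (D : seq bool) (i j : nat) : nat :=
  count_mem true (subpath D i j) - 1.

Lemma peak_bound m (D : dyck m) k : k <= size D -> k + height D k <= size D.
Proof.
move=> kD; have [sD rD lD] := dyckP D; have := rises_falls kD.
have : rises D k <= m.
  by rewrite -[X in _ <= X]rD /rises -sD take_size -[in leqRHS](cat_take_drop k D)
             count_cat leq_addr.
by rewrite /height; lia.
Qed.

Lemma extended_ascent_bound m (D : dyck m) (k : nat) pt : k \in peaks D ->
  on_extended_ascent D k pt -> pt.1 + pt.2 <= size D.
Proof.
case/mem_peaks => _ /ltnW /peak_bound kn _ _.
by rewrite /on_extended_ascent; lia.
Qed.

Lemma descent_complete m (D : dyck m) fuel x y :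
  x + y <= (size D).+2 -> (size D).+2 <= fuel + x ->
  count_mem false (descent D fuel x y) = y + count_mem true (descent D fuel x y).
Proof.
elim: fuel x y => [|fuel IH] x [|y] //=; try lia.
move=> xy fx; case: ifP => [/andP [y0 /hasP [k kD on_k]]|_] /=.
  by have /= := extended_ascent_bound kD on_k => ?; rewrite IH ?addnS ?add0n ?add1n //; lia.
by rewrite IH ?add1n ?add0n //; lia.
Qed.

Lemma subpath_complete n (D : dyck n.+1) i j : (i, j) \in ascent_blocks n D ->
  count_mem false (subpath D i j) = count_mem true (subpath D i j).
Proof.
rewrite mem_filter mem_blocks => /andP [/hasP [k kD /andP [_ on_k]]].
case/and3P => /= i0 ij jn; have /= := extended_ascent_bound kD on_k => ?.
by rewrite /subpath /= !count_cat !count_nseq descent_complete /=; lia.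
Qed.

(* Main.v *)
Require Import Defs.
From mathcomp Require Import all_boot all_order all_algebra.
From mathcomp Require Import zify ring.

Set Implicit Arguments.
Unset Strict Implicit.
Unset Printing Implicit Defensive.

Import GRing.Theory.
Local Open Scope ring_scope.

(* The dimension is the number of words in the commutation class, and a class is
   determined by its projections onto pairs of adjacent letters.  The word of D
   is a concatenation of decreasing rows T_I^m, one per peak, with I and m
   strictly increasing.  The possible last letters of the class are the ends I_r
   of the rows that can be shortened keeping I strictly increasing, so the words
   correspond to lattice walks from I to m + 1 in a Weyl chamber.  The hypothesis
   on ascents says that inside a connected component m grows by steps of 1, i.e.
   the heap is a disjoint union of Young diagrams.  With N_r the value of m + 1
   in the last row of the component of r, the number of walks is
   k! prod (I_t - I_r) / prod (N_r - I_r)!, the first product running over the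
   pairs r < t in a component: the recursion amounts to
   sum_r (N_r - I_r) prod_t (1 - 1/(I_t - I_r)) = k, proved by adding one row at
   a time and expanding the product in partial fractions.  Within a row, the
   differences I_t - I_r and the numbers p_D(r, j) together exhaust
   1, ..., N_r - I_r. *)

(** * Commutation classes and lattice walks *)

Section Projections.
Local Open Scope nat_scope.

(** Distinct letters fail to commute exactly when they are neighbours a, a + 1, so these projections
    determine a word up to commutation. *)
Definition same_projections (u v : word) : Prop :=
  forall a, filter (two_letters a) u = filter (two_letters a) v.

Lemma same_projections_perm u v : same_projections u v -> perm_eq u v.
Proof.
move=> uv; apply/allP => x _ /=; apply/eqP.
have cE w : count_mem x w = count_mem x (filter (two_letters x) w).
  rewrite count_filter; apply: eq_count => y /=.
  by rewrite /two_letters /=; case: eqP.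
by rewrite cE [RHS]cE uv.
Qed.

Lemma same_projections_rcons u v x :
  same_projections (rcons u x) (rcons v x) <-> same_projections u v.
Proof.
split=> uv a; last by rewrite !filter_rcons uv.
by have := uv a; rewrite !filter_rcons; case: ifP => // _ /rcons_inj [].
Qed.

(** A projection keeping x starts with x on the right, so it keeps no letter of u1, which avoids x.
    A letter y of u1 not commuting with x would survive in the projection indexed by [minn x y]. *)
Lemma same_projections_cons u1 u2 v x :
  x \notin u1 -> same_projections (u1 ++ x :: u2) (x :: v) ->
  all (distant x) u1 /\ same_projections (u1 ++ u2) v.
Proof.
move=> xu1 uv.
have nil a : two_letters a x -> filter (two_letters a) u1 = [::].
  move=> ax; have := uv a; rewrite filter_cat /= ax.
  case E: (filter (two_letters a) u1) => [//|y s] [yx _].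
  have : y \in filter (two_letters a) u1 by rewrite E mem_head.
  by rewrite mem_filter yx (negPf xu1) andbF.
have dis : all (distant x) u1.
  apply/allP => y yu1; apply: contraNT xu1 => dxy.
  have ax : two_letters (minn x y) x.
    by move: dxy; rewrite /two_letters /distant /=; lia.
  have ay : two_letters (minn x y) y.
    by move: dxy; rewrite /two_letters /distant /=; lia.
  have : y \in filter (two_letters (minn x y)) u1 by rewrite mem_filter ay.
  by rewrite nil.
split=> // a; have := uv a; rewrite !filter_cat /=; case: ifP => // /nil ->.
by case.
Qed.

Lemma commutation_step_cat al (w w' : Ialpha al) s a b t :
  ssval w = s ++ [:: a, b & t] -> ssval w' = s ++ [:: b, a & t] ->
  distant a b -> commutation_step w w'.
Proof.
move=> wE w'E dab.
have sz : (size s).+1 < size al by rewrite -(size_Ialpha w) wE size_cat /=; lia.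
apply/existsP; exists (Ordinal (ltnW sz)) => /=; rewrite sz /= /letter wE.
rewrite !nth_cat ltnn subnn ifF; last by lia.
rewrite subSnn /= dab; apply/eqP/Ialpha_eq => /=.
by rewrite w'E wE /swap take_size_cat // drop_size_cat.
Qed.

Lemma commute_to_front al s u1 u2 x : all (distant x) u1 ->
  forall w w' : Ialpha al, ssval w = s ++ u1 ++ x :: u2 ->
  ssval w' = s ++ x :: u1 ++ u2 -> connect (@commutation_step al) w w'.
Proof.
elim/last_ind: u1 u2 => [|u1 y IH] u2.
  by move=> _ w w' /= wE w'E; rewrite (_ : w = w') //; apply: Ialpha_eq; rewrite wE.
rewrite all_rcons => /andP [dxy du1] w w' wE w'E.
have w1P : (s ++ u1 ++ x :: y :: u2) \in permutations al.
  have := ssvalP w; rewrite !mem_permutations; apply: perm_trans.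
  by rewrite wE perm_cat2l cat_rcons perm_cat2l -[x :: y :: _]/([:: x] ++ [:: y] ++ _) perm_catCA.
apply: connect_trans (connect1 _) (IH (y :: u2) du1 (SeqSub w1P) w' _ _) => //.
- apply: (@commutation_step_cat _ _ _ (s ++ u1) y x u2) => //=.
  + by rewrite wE cat_rcons catA.
  + by rewrite catA.
  + by move: dxy; rewrite /distant orbC.
- by rewrite w'E cat_rcons.
Qed.

(* The letters preceding the first occurrence of x in a word whose class has a
   representative starting with x all commute with x. *)
Lemma same_projections_connect al s u v : same_projections u v ->
  forall w w' : Ialpha al, ssval w = s ++ u -> ssval w' = s ++ v ->
  connect (@commutation_step al) w w'.
Proof.
elim: v s u => [|x v IH] s u uv w w' wE w'E.
  have /perm_nilP u0 := same_projections_perm uv.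
  by rewrite (_ : w = w') //; apply: Ialpha_eq; rewrite wE w'E u0.
have xu : x \in u by rewrite (perm_mem (same_projections_perm uv)) mem_head.
have ix : index x u < size u by rewrite index_mem.
have uE : u = take (index x u) u ++ x :: drop (index x u).+1 u.
  by rewrite -{1}(cat_take_drop (index x u) u) (drop_nth x) ?nth_index.
have xu1 : x \notin take (index x u) u by rewrite in_take // ltnn.
move: (take _ u) (drop _ u) uE xu1 => u1 u2 uE xu1; rewrite uE in uv wE.
have [du1 uv'] := same_projections_cons xu1 uv.
have w1P : (s ++ x :: u1 ++ u2) \in permutations al.
  have := ssvalP w; rewrite !mem_permutations wE; apply: perm_trans.
  by rewrite perm_cat2l -[x :: u1 ++ u2]/([:: x] ++ u1 ++ u2) perm_catCA.
apply: connect_trans (commute_to_front du1 wE (w' := SeqSub w1P) erefl) _.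
by apply: (IH (rcons s x) (u1 ++ u2)); rewrite //= cat_rcons.
Qed.

Lemma mem_commutation_class al (w w' : Ialpha al) :
  w' \in commutation_class w <-> same_projections (ssval w') (ssval w).
Proof.
split=> [ww' a|ww']; first exact: filter_commutation.
by rewrite inE; apply: (@same_projections_connect al [::] (ssval w) (ssval w')).
Qed.

Lemma card_commutation_class al (w : Ialpha al) (s : seq word) :
  uniq s -> (forall u, u \in s <-> same_projections u (ssval w)) ->
  #|commutation_class w| = size s.
Proof.
move=> us sP; rewrite cardE -(size_map (@ssval _ _)); apply/perm_size/uniq_perm => //.
  by rewrite map_inj_uniq ?enum_uniq //; apply: val_inj.
move=> u; apply/mapP/idP => [[w']|us'].
  by rewrite mem_enum => /mem_commutation_class w'w ->; apply/sP.
have uP : u \in permutations al.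
  rewrite mem_permutations; have := ssvalP w; rewrite mem_permutations.
  by apply: perm_trans; apply: same_projections_perm; apply/sP.
by exists (SeqSub uP) => //; rewrite mem_enum; apply/mem_commutation_class/sP.
Qed.

End Projections.

(** * Words of a class as walks of the row ends *)

Section Walks.
Local Open Scope nat_scope.
Variables (l : nat) (m : nat -> nat).
Hypothesis m_incr : forall r, r.+1 < l -> m r < m r.+1.

Definition rows_word (I : nat -> nat) (s : seq nat) : word :=
  flatten [seq block_word (I r, m r) | r <- s].

(** The chamber of the walks. The value m r + 1 of [I r] encodes an exhausted row. *)
Definition strict_rows (I : nat -> nat) : Prop :=
  (forall r, r < l -> I r <= (m r).+1) /\ (forall r, r.+1 < l -> I r < I r.+1).

Definition incr_row (I : nat -> nat) (r t : nat) : nat := I t + (t == r).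

Definition removable (I : nat -> nat) (r : nat) : bool :=
  (I r <= m r) && ((r.+1 == l) || ((I r).+1 < I r.+1)).

Fixpoint walk_words (k : nat) (I : nat -> nat) : seq word :=
  if k is k'.+1 then
    flatten [seq [seq rcons u (I r) | u <- walk_words k' (incr_row I r)]
            | r <- iota 0 l & removable I r]
  else [:: [::]].

Definition walk_length (I : nat -> nat) : nat :=
  \sum_(r <- iota 0 l) ((m r).+1 - I r).

Lemma ltn_homo (f : nat -> nat) : (forall r, r.+1 < l -> f r < f r.+1) ->
  forall r t, r < t -> t < l -> f r < f t.
Proof.
move=> fS r; elim=> // t IH; rewrite ltnS leq_eqVlt => /orP [/eqP ->|rt] tl.
  exact: fS.
by apply: ltn_trans (fS _ tl); apply: IH => //; apply: ltnW.
Qed.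

Lemma strict_rows_incr I r : strict_rows I -> r < l -> removable I r ->
  strict_rows (incr_row I r).
Proof.
case=> I1 I2 rl /andP [Ir rS]; split=> t tl; rewrite /incr_row.
  by have := I1 t tl; case: eqP => [->|]; lia.
have := I2 t tl; case: (t =P r) => [tr|]; last by case: eqP; lia.
by move: rS; rewrite tr; lia.
Qed.

Lemma walk_length_incr I r : r < l -> removable I r ->
  walk_length I = (walk_length (incr_row I r)).+1.
Proof.
move=> rl /andP [Ir _]; rewrite /walk_length.
rewrite (bigD1_seq r) ?mem_iota ?iota_uniq //= [in RHS](bigD1_seq r) ?mem_iota ?iota_uniq //=.
rewrite /incr_row eqxx -addSn; congr addn; first by lia.
by apply: eq_bigr => t /negPf ->; rewrite addn0.
Qed.

Lemma iota_split r : r < l -> iota 0 l = iota 0 r ++ r :: iota r.+1 (l - r.+1).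
Proof. by move=> rl; rewrite -{1}(subnKC (ltnW rl)) iotaD add0n -(subnSK rl). Qed.

Lemma rows_word_cat I s1 s2 : rows_word I (s1 ++ s2) = rows_word I s1 ++ rows_word I s2.
Proof. by rewrite /rows_word map_cat flatten_cat. Qed.

Lemma mem_rows_word I s x :
  (x \in rows_word I s) = has (fun r => I r <= x <= m r) s.
Proof.
elim: s => //= r s IH; rewrite /rows_word /= mem_cat -/(rows_word I s) IH; congr orb.
by rewrite mem_rev mem_iota /=; lia.
Qed.

(** The rows after a removable row r only have letters at least I r + 2, which commute with [I r],
    so this letter can be moved to the end. *)
Lemma rows_word_incr I r : strict_rows I -> r < l -> removable I r ->
  same_projections (rows_word I (iota 0 l))
                   (rcons (rows_word (incr_row I r) (iota 0 l)) (I r)).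
Proof.
move=> [I1 I2] rl rem a; rewrite filter_rcons.
have out s : r \notin s -> rows_word (incr_row I r) s = rows_word I s.
  move=> rs; congr flatten; apply/eq_in_map => t ts.
  by rewrite /incr_row (negPf (_ : t != r)) ?addn0 //; apply: contraNneq rs => <-.
rewrite !(iota_split rl) -!cat_rcons !rows_word_cat !filter_cat.
rewrite (out (iota r.+1 _)) ?mem_iota ?ltnn //.
set after := rows_word I (iota r.+1 _).
have row_r : rows_word I (rcons (iota 0 r) r) =
    rcons (rows_word (incr_row I r) (rcons (iota 0 r) r)) (I r).
  rewrite -!cats1 !rows_word_cat -catA out ?mem_iota ?ltnn //; congr cat.
  rewrite /rows_word /= !cats0 /incr_row eqxx /block_word /= addn1 cats1 -rev_cons.
  by case/andP: rem => Ir _; rewrite subSS subSn.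
rewrite row_r filter_rcons; case: ifP => // ax; rewrite !cat_rcons.
suff -> : filter (two_letters a) after = [::] by rewrite !cats0 cats1.
apply/eqP; rewrite -[_ == _]negbK -has_filter; apply/hasPn => y.
rewrite mem_rows_word => /hasP [t]; rewrite mem_iota => tr ty.
have It : I r.+1 <= I t.
  have [->//|rt] := eqVneq t r.+1.
  by apply/ltnW/(ltn_homo I2); lia.
by move: rem ax; rewrite /removable /two_letters /=; lia.
Qed.

Lemma rows_word_last I u x : strict_rows I ->
  same_projections (rcons u x) (rows_word I (iota 0 l)) ->
  exists r, [/\ r < l, removable I r & I r = x].
Proof.
move=> [I1 I2] ux.
have : x \in rows_word I (iota 0 l).
  by rewrite -(perm_mem (same_projections_perm ux)) mem_rcons mem_head.
rewrite mem_rows_word => /hasP [t]; rewrite mem_iota /= => tl /andP [Itx xmt].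
(* Take the last row r with [I r <= x]; later rows contain only letters above x. *)
have ex : exists r, (r < l) && (I r <= x) by exists t; rewrite tl.
have bound r : (r < l) && (I r <= x) -> r <= l by lia.
case: (ex_maxnP ex bound) => r /andP [rl Irx] rmax.
have later y : y \in rows_word I (iota r.+1 (l - r.+1)) -> x < y.
  rewrite mem_rows_word => /hasP [q]; rewrite mem_iota => rq /andP [Iq _].
  by have := rmax q; lia.
have xmr : x <= m r.
  have tr : t <= r by apply: rmax; rewrite tl.
  have [<-//|tr'] := eqVneq t r.
  by have := ltn_homo m_incr (r := t) (t := r); lia.
have lastE a : two_letters a x -> last 0 (filter (two_letters a)
    (rows_word I (iota 0 l))) = x.
  by move=> ax; rewrite -ux filter_rcons ax last_rcons.
have Ir : I r = x.
  (* If [I r < x], row r has x - 1 after x, and the projection onto x - 1, x would end in x - 1. *)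
  apply: contraTeq (leqnn x) => Ix.
  have := lastE x.-1; rewrite (iota_split rl) -cat_rcons -cats1 !rows_word_cat !filter_cat.
  rewrite [filter _ (rows_word I (iota r.+1 _))](_ : _ = [::]); last first.
    apply/eqP; rewrite -[_ == _]negbK -has_filter; apply/hasPn => y /later.
    by rewrite /two_letters /=; lia.
  rewrite cats0 /rows_word /= cats0 filter_block_word /= last_cat.
  rewrite (_ : I r <= x.-1 <= m r); last by lia.
  rewrite last_cat /= /two_letters /=; lia.
exists r; split=> //; rewrite /removable Ir xmr /=.
have [//|rS] := eqVneq r.+1 l; have rl' : r.+1 < l by lia.
(* If [I r.+1] were x + 1, then, m being increasing, row r + 1 would contain x + 1, and the
   projection onto x, x + 1 could not end in x. *)
have := I2 r rl'; rewrite Ir leq_eqVlt => /orP [/eqP xE|//].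
have := lastE x; rewrite (iota_split rl) -cat_rcons rows_word_cat filter_cat last_cat.
have : x.+1 \in filter (two_letters x) (rows_word I (iota r.+1 (l - r.+1))).
  rewrite mem_filter /two_letters /= eqxx orbT mem_rows_word; apply/hasP.
  exists r.+1; first by rewrite mem_iota; lia.
  by have := m_incr rl'; lia.
case E: (filter _ (rows_word I (iota r.+1 _))) => [//|y s] _ /=.
have : last y s \in y :: s by apply: mem_last.
rewrite -E mem_filter => /andP [_ /later] xl H.
by have := H _; rewrite /two_letters /= eqxx => /(_ isT); lia.
Qed.

Lemma mem_walk_words k I : strict_rows I -> walk_length I = k -> forall u,
  u \in walk_words k I <-> same_projections u (rows_word I (iota 0 l)).
Proof.
elim: k I => [|k IH] I Istr Ik u /=.
  have full r : r < l -> m r < I r.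
    move=> rl; move/eqP: Ik; rewrite sum_nat_seq_eq0 => /allP /(_ r).
    by rewrite mem_iota rl /= => /(_ isT); lia.
  have -> : rows_word I (iota 0 l) = [::].
    case E: (rows_word I (iota 0 l)) => [//|x s].
    have : x \in rows_word I (iota 0 l) by rewrite E mem_head.
    by rewrite mem_rows_word => /hasP [r]; rewrite mem_iota /= => /full; lia.
  rewrite inE; split=> [/eqP -> //|/same_projections_perm].
  by move/perm_nilP ->.
have wI := rows_word_incr Istr.
have IHr r (rl : r < l) (rem : removable I r) := IH _ (strict_rows_incr Istr rl rem).
split=> [/flatten_mapP [r]|uI].
  rewrite mem_filter mem_iota /= => /andP [rem rl] /mapP [v vP -> a].
  rewrite (wI r rl rem); move: a; apply/same_projections_rcons/IHr => //.
  by apply: succn_inj; rewrite -Ik -walk_length_incr.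
case: (lastP u) uI => [|v x] uI.
  have /perm_size := same_projections_perm uI.
  move: Ik; rewrite /walk_length /rows_word size_flatten /shape -map_comp sumnE big_map.
  under eq_bigr => r _ do rewrite /= -[_ - _](size_iota (I r)) -size_rev.
  by move=> ->.
have [r [rl rem Ir]] := rows_word_last Istr uI.
apply/flatten_mapP; exists r; first by rewrite mem_filter mem_iota rem.
apply/mapP; exists v; last by rewrite Ir.
apply/IHr => //; first by apply: succn_inj; rewrite -Ik -walk_length_incr.
by apply/(same_projections_rcons _ _ x) => a; rewrite uI (wI r) // Ir.
Qed.

(** Walks with different first steps give words with different last letters, since I is strictly
    increasing. *)
Lemma uniq_walk_words k I : strict_rows I -> uniq (walk_words k I).
Proof.
elim: k I => //= k IH I Istr.
have [I1 I2] := Istr.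
have : {subset iota 0 l <= gtn l} by move=> r; rewrite mem_iota.
elim: (iota 0 l) (iota_uniq 0 l) => //= r s IHs /andP [rs us] sl.
have {}IHs := IHs us (fun t ts => sl t (@mem_behead _ (r :: s) t ts)).
case: ifP => //= rem; have rl : r < l := sl r (mem_head _ _).
rewrite cat_uniq map_inj_uniq; last by move=> x y /rcons_inj [].
rewrite IHs andbT IH; last exact: strict_rows_incr.
apply/hasPn => v /flatten_mapP [t]; rewrite mem_filter => /andP [_ ts] /mapP [u _ ->].
apply/negP => /mapP [u' _ /rcons_inj [_ E]].
have tl : t < l := sl t (@mem_behead _ (r :: s) t ts).
case: (ltngtP r t) => [rt|tr|rt].
- by have := ltn_homo I2 rt tl; lia.
- by have := ltn_homo I2 tr rl; lia.
- by move: rs; rewrite rt ts.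
Qed.

Lemma size_walk_words k I :
  size (walk_words k.+1 I) =
    \sum_(r <- iota 0 l | removable I r) size (walk_words k (incr_row I r)).
Proof.
rewrite /= size_flatten /shape -map_comp sumnE big_map big_filter.
by apply: eq_bigr => r _; rewrite /= size_map.
Qed.

End Walks.

(** * Partial fractions *)

Section Interpolation.
Variables (T K : eqType) (F : fieldType) (N : T -> K) (x : T -> F).

(** N labels components, and only indices with equal label interact. The value is the ratio by which
    the product of differences changes when [x r] grows by 1, and also the coefficient of the pole
    at [x r] in [partial_fractions]. *)
Definition coef (s : seq T) (r : T) : F :=
  \prod_(t <- s | (t != r) && (N t == N r)) (1 - (x t - x r)^-1).

Definition separated (s : seq T) : Prop :=
  uniq s /\ {in s &, forall r t, N r = N t -> r != t -> x t - x r != 0}.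

Lemma separated_cons b s : separated (b :: s) ->
  [/\ b \notin s, separated s & {in s, forall t, N t = N b -> x b - x t != 0}].
Proof.
case=> /= /andP [bs us] sep; split=> //.
  by split=> // r t rs ts; apply: sep; rewrite inE ?rs ?ts orbT.
move=> t ts Nt; apply: sep => //; rewrite ?mem_head ?inE ?ts ?orbT //.
by apply: contraNneq bs => <-.
Qed.

Lemma coef_cons b s r : coef (b :: s) r =
  (if (b != r) && (N b == N r) then 1 - (x b - x r)^-1 else 1) * coef s r.
Proof. by rewrite /coef big_cons; case: ifP => // _; rewrite mul1r. Qed.

Lemma coef_head b s : b \notin s ->
  coef (b :: s) b = \prod_(t <- s | N t == N b) (1 - (x t - x b)^-1).
Proof.
move=> bs; rewrite coef_cons eqxx mul1r /coef [LHS]big_seq_cond [RHS]big_seq_cond.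
apply: eq_bigl => t; case: (boolP (t \in s)) => //= ts.
by rewrite (_ : t != b) //; apply: contraNneq bs => <-.
Qed.

Lemma coef_tail b s r : b \notin s -> r \in s ->
  coef (b :: s) r = (if N r == N b then 1 - (x b - x r)^-1 else 1) * coef s r.
Proof.
move=> bs rs; rewrite coef_cons eq_sym (_ : r != b) 1?[N b == _]eq_sym //.
by apply: contraNneq bs => <-.
Qed.

Lemma partial_fractions s z n : separated s ->
  {in s, forall t, N t = n -> x t - z != 0} ->
  \prod_(t <- s | N t == n) (1 - (x t - z)^-1) =
    1 - \sum_(t <- s | N t == n) coef s t / (x t - z).
Proof.
elim: s z => [|b s IH] z; first by rewrite !big_nil subr0.
move=> sep zs; have [bs seps sepb] := separated_cons sep.
have {}zs : {in b :: s, forall t, N t = n -> x t - z != 0} := zs.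
have {}IH := IH _ seps.
rewrite !big_cons; case: eqP => Nb; last first.
  rewrite IH => [|t ts]; last by apply: zs; rewrite inE ts orbT.
  congr (_ - _); rewrite [LHS]big_seq_cond [RHS]big_seq_cond.
  apply: eq_bigr => t /andP [ts /eqP Nt].
  by rewrite coef_tail // Nt ifF ?mul1r //; apply/eqP => E; case: Nb.
have zb := zs b (mem_head _ _) Nb.
(* The induction hypothesis is used both at z and at [x b], where it gives the coefficient of the
   new pole. *)
rewrite coef_head // Nb IH => [|t ts]; last by apply: zs; rewrite inE ts orbT.
rewrite IH => [|t ts Nt]; last by rewrite -opprB oppr_eq0 sepb // Nb.
rewrite [X in _ = 1 - (_ + X)](_ : _ =
    (1 - (x b - z)^-1) * (\sum_(t <- s | N t == n) coef s t / (x t - z)) +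
    (x b - z)^-1 * (\sum_(t <- s | N t == n) coef s t / (x t - x b))).
  by field.
rewrite !mulr_sumr -big_split [LHS]big_seq_cond [RHS]big_seq_cond.
apply: eq_bigr => t /andP [ts /eqP Nt] /=.
rewrite coef_tail // Nt Nb eqxx.
have := zs t (mem_behead (s := b :: s) ts) Nt.
have : x b - x t != 0 by apply: sepb => //; rewrite Nb.
move=> h1 h2; have h3 : x t - x b != 0 by rewrite -opprB oppr_eq0.
by field; rewrite h1 h2 h3 zb.
Qed.

(** This compares the 1/z terms at infinity in [partial_fractions]. In the induction, a new b
    contributes 1 - S and multiplies each old coefficient by 1 + 1/(x t - x b), which adds S
    back. *)
Lemma sum_coef s n : separated s ->
  \sum_(t <- s | N t == n) coef s t = (count (fun t => N t == n) s)%:R.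
Proof.
elim: s => [|b s IH]; first by rewrite big_nil.
move=> sep; have [bs seps sepb] := separated_cons sep.
have {}IH := IH seps; rewrite big_cons /=.
case: eqP => Nb; last first.
  rewrite add0n -IH [LHS]big_seq_cond [RHS]big_seq_cond.
  apply: eq_bigr => t /andP [ts /eqP Nt].
  by rewrite coef_tail // Nt ifF ?mul1r //; apply/eqP => E; case: Nb.
rewrite coef_head // partial_fractions ?Nb //; last first.
  by move=> t ts Nt; rewrite -opprB oppr_eq0 sepb // Nb.
rewrite natrD mulr1n -IH [X in _ + X](_ : _ = \sum_(t <- s | N t == n) coef s t +
    \sum_(t <- s | N t == n) coef s t / (x t - x b)); first by ring.
rewrite -big_split [LHS]big_seq_cond [RHS]big_seq_cond.
apply: eq_bigr => t /andP [ts /eqP Nt] /=; rewrite coef_tail // Nt Nb eqxx.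
have h1 : x b - x t != 0 by apply: sepb => //; rewrite Nb.
have h3 : x t - x b != 0 by rewrite -opprB oppr_eq0.
by field; rewrite h1 h3.
Qed.

Fixpoint same_pairs (s : seq T) : nat :=
  if s is b :: s' then (count (fun t => N t == N b) s' + same_pairs s')%N else 0%N.

(** Let S be the sum of coef s t / (x t - x b) over the component of b. Prepending b adds (y - x
    b)(1 - S) for b itself, and (y - x b) S minus the sum of the coefficients for the others. S
    cancels, and [sum_coef] evaluates the rest. *)
Lemma sum_mul_coef (y : K -> F) s : separated s ->
  \sum_(t <- s) (y (N t) - x t) * coef s t =
    \sum_(t <- s) (y (N t) - x t) - (same_pairs s)%:R.
Proof.
elim: s => [|b s IH]; first by rewrite !big_nil subr0.
move=> sep; have [bs seps sepb] := separated_cons sep.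
have {}IH := IH seps; rewrite !big_cons /= coef_head // partial_fractions //; last first.
  by move=> t ts Nt; rewrite -opprB oppr_eq0 sepb.
rewrite natrD -sum_coef //.
rewrite [X in _ + X](_ : _ = \sum_(t <- s) (y (N t) - x t) * coef s t +
    \sum_(t <- s | N t == N b) (y (N b) - x t) * coef s t / (x t - x b)); last first.
  rewrite [X in _ + X]big_mkcond -big_split [LHS]big_seq [RHS]big_seq.
  apply: eq_bigr => t ts /=; rewrite coef_tail //.
  case: eqP => Nt; last by rewrite mul1r addr0.
  have h1 : x b - x t != 0 by apply: sepb.
  have h3 : x t - x b != 0 by rewrite -opprB oppr_eq0.
  by rewrite Nt; field; rewrite h1 h3.
rewrite IH.
have -> : \sum_(t <- s | N t == N b) (y (N b) - x t) * coef s t / (x t - x b) =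
    (y (N b) - x b) * (\sum_(t <- s | N t == N b) coef s t / (x t - x b)) -
    \sum_(t <- s | N t == N b) coef s t.
  rewrite mulr_sumr -sumrB [LHS]big_seq_cond [RHS]big_seq_cond.
  apply: eq_bigr => t /andP [ts /eqP Nt] /=.
  have h3 : x t - x b != 0 by rewrite -opprB oppr_eq0 sepb.
  by field.
by ring.
Qed.

Fixpoint vandermonde (s : seq T) : F :=
  if s is b :: s' then
    (\prod_(t <- s' | N t == N b) (x t - x b)) * vandermonde s'
  else 1.

End Interpolation.

Lemma eq_vandermonde (T K : eqType) (F : fieldType) (N : T -> K) (x x' : T -> F) s :
  {in s, x =1 x'} -> vandermonde N x s = vandermonde N x' s.
Proof.
elim: s => //= b s IH xx'; rewrite IH => [|t ts]; last by apply: xx'; rewrite inE ts orbT.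
congr (_ * _); rewrite [LHS]big_seq_cond [RHS]big_seq_cond; apply: eq_bigr => t /andP [ts _].
by rewrite !xx' ?mem_head // inE ts orbT.
Qed.

(** Only differences involving r change, each by the factor 1 - 1/(x t - x r), whichever of r and t
    comes first in s. *)
Lemma vandermonde_incr (T K : eqType) (F : fieldType) (N : T -> K) (x : T -> F) s r :
  separated N x s -> r \in s ->
  vandermonde N (fun t => x t + (t == r)%:R) s = vandermonde N x s * coef N x s r.
Proof.
elim: s => //= b s IH sep; have [bs seps sepb] := separated_cons sep.
have ne t : t \in s -> (t == b) = false by move=> ts; apply: contraNF bs => /eqP <-.
rewrite inE; case: (eqVneq r b) => [-> _|rb /= rs].
  rewrite (eq_vandermonde _ (x' := x)) => [|t ts]; last by rewrite ne // addr0.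
  rewrite coef_head // mulrAC -big_split; congr (_ * _).
  rewrite [LHS]big_seq_cond [RHS]big_seq_cond.
  apply: eq_bigr => t /andP [ts /eqP Nt] /=; rewrite (ne t ts) mulr0n mulr1n.
  have h3 : x t - x b != 0 by rewrite -opprB oppr_eq0 sepb.
  by field.
rewrite IH // coef_tail // addr0.
rewrite [X in X * _ = _](_ : _ = (if N r == N b then 1 - (x b - x r)^-1 else 1) *
   \prod_(t <- s | N t == N b) (x t - x b)); first by ring.
have us : uniq s by case: seps.
case: ifP => Nr; last first.
  rewrite mul1r [LHS]big_seq_cond [RHS]big_seq_cond; apply: eq_bigr => t /andP [_ Nt].
  by rewrite (_ : t == r = false) ?addr0 //; apply/eqP => E; rewrite -E Nt in Nr.
rewrite big_mkcond [X in _ = _ * X]big_mkcond.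
rewrite !(bigD1_seq r) //= Nr eqxx mulr1n.
rewrite (eq_bigr (fun t => if N t == N b then x t - x b else 1)); last first.
  by move=> t /negPf ->; rewrite addr0.
have h1 : x b - x r != 0 by apply: sepb => //; apply/eqP.
have h3 : x r - x b != 0 by rewrite -opprB oppr_eq0.
by field.
Qed.

(** * Hook length formula for disjoint unions of Young diagrams *)

Section Hooks.
Local Open Scope nat_scope.
Variables (l : nat) (m : nat -> nat).
Hypothesis m_incr : forall r, r.+1 < l -> m r < m r.+1.

(* Rows r < t lie in the same connected component of the heap iff
   m t = m r + (t - r); row_end is constant on components. *)
Definition row_end (r : nat) : nat :=
  (m r).+1 + count (fun t => m t == m r + (t - r)) (iota r.+1 (l - r.+1)).

Local Notation N := row_end.

Lemma row_end_last r : r.+1 = l -> N r = (m r).+1.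
Proof. by move=> rl; rewrite /row_end rl subnn addn0. Qed.

(** As m increases strictly, m t - t is nondecreasing, so a gap after row r is never made up and
    closes the component. *)
Lemma row_end_step r : r.+1 < l ->
  (m r.+1 = (m r).+1 /\ N r.+1 = N r) \/
  [/\ (m r).+1 < m r.+1, N r = (m r).+1 & N r < N r.+1].
Proof.
move=> rl; rewrite /row_end.
have -> : l - r.+1 = (l - r.+2).+1 by lia.
rewrite /=; have [mE|mN] := eqVneq (m r.+1) (m r).+1.
  left; split=> //; rewrite mE subSnn addn1 eqxx addnA addn1; congr addn.
  by apply: eq_in_count => t; rewrite mem_iota => rt; lia.
right; rewrite (_ : _ + count _ _ = 0); first by have := m_incr rl; split; lia.
rewrite (_ : m r.+1 == _ = false) //=; last by lia.
apply/eqP; rewrite -leqn0 leqNgt -has_count; apply/hasPn => t.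
rewrite mem_iota => rt.
have : m r.+1 + (t - r.+1) <= m t; last by have := m_incr rl; lia.
have [n tn nl] : exists2 n, t = r.+2 + n & r.+2 + n < l by exists (t - r.+2); lia.
rewrite tn; elim: n nl {tn} => [|n IH]; rewrite ?addn0 ?addnS => nl.
  by have := m_incr nl; lia.
by have := m_incr (r := r.+2 + n); lia.
Qed.

Lemma row_end_gt r : m r < N r.
Proof. by rewrite /row_end; lia. Qed.

Lemma row_end_mono r t : r <= t -> t < l -> N r <= N t.
Proof.
elim: t => [|t IH]; first by rewrite leqn0 => /eqP ->.
rewrite leq_eqVlt => /orP [/eqP -> //|rt] tl.
by have := IH rt (ltnW tl); case: (row_end_step tl) => [[_ ->]|[]]; lia.
Qed.

Lemma row_end_count d r : r + d.+1 = l ->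
  N r = (m r).+1 + count (fun t => N t == N r) (iota r.+1 d).
Proof.
elim: d r => [|d IH] r rd; first by rewrite row_end_last ?addn0 //; lia.
have rl : r.+1 < l by lia.
case: (row_end_step rl) => [[mE NE]|[_ mE NE]] /=.
  by rewrite NE eqxx -[LHS]NE IH ?mE ?NE; lia.
rewrite (_ : _ + count _ _ = 0) ?addn0 //.
rewrite (_ : N r.+1 == N r = false) //=; last by lia.
apply/eqP; rewrite -leqn0 leqNgt -has_count; apply/hasPn => t.
rewrite mem_iota => rt; have := @row_end_mono r.+1 t; lia.
Qed.

(* The number of boxes below the box of letter j in a row, where s lists the
   last letters of the following rows; going down a column, the letter increases
   by 1 at each row. *)
Fixpoint leg (s : seq nat) (j : nat) : nat :=
  if s is x :: s' then if x <= j.+1 then (leg s' j.+1).+1 else 0 else 0.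

Lemma fact_prod i lo hi : i <= lo -> lo <= hi ->
  (lo - i)`! * \prod_(lo <= j < hi) (j - i + 1) = (hi - i)`!.
Proof.
move=> ilo; elim: hi => [|hi IH] lohi.
  by rewrite big_geq ?muln1 //; have -> : lo = 0 by lia.
have [->|ne] := eqVneq lo hi.+1; first by rewrite big_geq ?muln1.
have lohi' : lo <= hi by lia.
rewrite big_nat_recr //= mulnA IH // addn1 mulnC.
by have -> : hi.+1 - i = (hi - i).+1 by lia.
Qed.

(** In the second case all letters of rows r and r + 1 commute with each other. Both cases persist
    when I grows, hence along walks. *)
Definition component_rows (I : nat -> nat) : Prop :=
  forall r, r.+1 < l -> m r.+1 = (m r).+1 \/ (m r).+1 < I r.+1.

(** The factors on the left run through 1, ..., N r - i once each. The factorial covers the values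
    already passed while the induction descends the component with i fixed. *)
Lemma hook_row_rec I d r i lo : strict_rows l m I -> component_rows I ->
  r + d.+1 = l -> i <= lo -> lo <= (m r).+1 -> (0 < d -> lo < I r.+1) ->
  (lo - i)`! *
    \prod_(lo <= j < (m r).+1) (j - i + 1 + leg [seq I t | t <- iota r.+1 d] j) *
    \prod_(t <- iota r.+1 d | N t == N r) (I t - i) = (N r - i)`!.
Proof.
move=> [I1 I2] Ic; elim: d r lo => [|d IH] r lo rd ilo lom loI.
  rewrite big_nil muln1 row_end_last; last by lia.
  by rewrite -(fact_prod ilo lom); congr muln; apply: eq_bigr => j _; rewrite addn0.
have rl : r.+1 < l by lia.
have Ir := I1 _ rl; have {}loI := loI isT.
case: (row_end_step rl) => [[mE NE]|[mlt NE Nlt]]; last first.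
  rewrite [X in _ * X]big1_seq ?muln1; last first.
    move=> t /andP [/eqP Nt]; rewrite mem_iota => rt.
    by have := @row_end_mono r.+1 t; lia.
  rewrite NE -(fact_prod ilo lom); congr muln.
  apply: eq_big_nat => j jr; rewrite /= ifF ?addn0 //.
  by have := Ic r rl; lia.
rewrite big_cons NE eqxx.
(* From letter q on, the boxes have a box of row r + 1 below, so their factors are those of row r +
   1 at the next letter. The value q + 1 - i skipped by the hooks is the difference factor of t = r
   + 1. *)
have [q qE] : exists q, I r.+1 = q.+1 by exists (I r.+1).-1; lia.
rewrite (@big_cat_nat _ _ _ q) //=; [|by lia|by lia].
rewrite -[in RHS]NE -(IH r.+1 q.+1); [|by lia|by lia|by lia|move=> d0; rewrite -qE; apply: I2; lia].
rewrite mE qE big_add1 /= NE.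
have -> : \prod_(lo <= j < q)
    (j - i + 1 + leg (q.+1 :: [seq I t | t <- iota r.+2 d]) j) =
    \prod_(lo <= j < q) (j - i + 1).
  by apply: eq_big_nat => j jr; rewrite /= ifF ?addn0 //; lia.
have -> : \prod_(q <= j < (m r).+1)
    (j - i + 1 + leg (q.+1 :: [seq I t | t <- iota r.+2 d]) j) =
    \prod_(q <= j < (m r).+1)
    (j.+1 - i + 1 + leg [seq I t | t <- iota r.+2 d] j.+1).
  by apply: eq_big_nat => j jr; rewrite /= ifT; lia.
have := @fact_prod i lo q ilo; have -> : q.+1 - i = (q - i).+1 by lia.
by rewrite factS => <-; [ring | lia].
Qed.

(** Each factor is the hook length of a box: arm j - I r, leg, and the box itself. *)
Definition hook_product (I : nat -> nat) : nat :=
  \prod_(r <- iota 0 l) \prod_(I r <= j < (m r).+1)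
    (j - I r + 1 + leg [seq I t | t <- iota r.+1 (l - r.+1)] j).

Lemma hook_row I r : strict_rows l m I -> component_rows I -> r < l ->
  \prod_(I r <= j < (m r).+1)
    (j - I r + 1 + leg [seq I t | t <- iota r.+1 (l - r.+1)] j) *
  \prod_(t <- iota r.+1 (l - r.+1) | N t == N r) (I t - I r) = (N r - I r)`!.
Proof.
move=> Istr Ic rl; have [I1 I2] := Istr.
rewrite -(hook_row_rec (d := l - r.+1) (lo := I r) Istr Ic) ?subnn ?fact0 ?mul1n //.
- by lia.
- exact: I1.
- by move=> rl'; apply: I2; lia.
Qed.

Lemma component_rows_incr I r : component_rows I -> component_rows (incr_row I r).
Proof. by move=> Ic t tl; rewrite /incr_row; have := Ic t tl; lia. Qed.

Local Open Scope ring_scope.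

Local Notation xcoord I := (fun t : nat => (I t)%:R : rat).
Local Notation fact_ends I := (\prod_(r <- iota 0 l) ((N r - I r)`!)%N).

Lemma strict_rows_separated I : strict_rows l m I ->
  separated N (xcoord I) (iota 0 l).
Proof.
move=> [_ I2]; split; first exact: iota_uniq.
move=> r t; rewrite !mem_iota /= => rl tl _ rt.
rewrite subr_eq0 Num.Theory.eqr_nat.
have [lt|gt|eq] := ltngtP r t; last by rewrite eq eqxx in rt.
- by have := ltn_homo I2 lt tl; lia.
- by have := ltn_homo I2 gt rl; lia.
Qed.

Lemma hook_product_vandermonde I : strict_rows l m I -> component_rows I ->
  (hook_product I)%:R * vandermonde N (xcoord I) (iota 0 l) = (fact_ends I)%:R.
Proof.
move=> Istr Ic; have [_ I2] := Istr; rewrite /hook_product.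
suff : forall d r, (r + d = l)%N ->
    (\prod_(r <- iota r d) \prod_(I r <= j < (m r).+1)
      (j - I r + 1 + leg [seq I t | t <- iota r.+1 (l - r.+1)] j)%N)%:R *
      vandermonde N (xcoord I) (iota r d) =
    (\prod_(r <- iota r d) ((N r - I r)`!)%N)%:R by apply.
elim=> [|d IH] r rd; first by rewrite !big_nil mulr1.
rewrite /= !big_cons !natrM -IH; last by lia.
have dE : (l - r.+1 = d)%N by lia.
rewrite -hook_row //; last by lia.
rewrite dE natrM [X in _ * (X * _)](_ : _ =
  (\prod_(t <- iota r.+1 d | N t == N r) (I t - I r)%N)%:R); first by ring.
rewrite natr_prod big_seq_cond [RHS]big_seq_cond; apply: eq_bigr => t /andP [tr _].
rewrite natrB //; apply/ltnW/(ltn_homo I2); move: tr; rewrite mem_iota; lia.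
Qed.

Lemma sum_row_lengths I : strict_rows l m I ->
  \sum_(t <- iota 0 l) ((N t)%:R - (I t)%:R) - (same_pairs N (iota 0 l))%:R =
    (walk_length l m I)%:R :> rat.
Proof.
move=> [I1 _]; rewrite /walk_length.
suff : forall d r, (r + d = l)%N ->
    \sum_(t <- iota r d) ((N t)%:R - (I t)%:R) - (same_pairs N (iota r d))%:R =
    (\sum_(t <- iota r d) ((m t).+1 - I t)%N)%:R :> rat by apply.
elim=> [|d IH] r rd; first by rewrite !big_nil subr0.
rewrite /= !big_cons (natrD _ (count _ _)) (natrD _ ((m r).+1 - I r)%N) -IH; last by lia.
rewrite natrB; last by apply: I1; lia.
have -> : (N r)%:R = (m r).+1%:R +
    (count (fun t => N t == N r) (iota r.+1 d))%:R :> rat.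
  by rewrite -natrD -(row_end_count rd).
by ring.
Qed.

(** This extends sums over removable rows to all rows. Either I r = N r, or the next row of the
    component ends at I r + 1 and contributes the factor 1 - 1/1. *)
Lemma nonremovable_coef I r : strict_rows l m I -> component_rows I -> (r < l)%N ->
  ~~ removable l m I r ->
  ((N r)%:R - (I r)%:R) * coef N (xcoord I) (iota 0 l) r = 0.
Proof.
move=> [I1 I2] Ic rl nrem; have Ir := I1 r rl.
have [rl'|rl'] := eqVneq r.+1 l.
  suff -> : I r = N r by rewrite subrr mul0r.
  by rewrite row_end_last //; move: nrem; rewrite /removable; lia.
have {}rl' : (r.+1 < l)%N by lia.
have Ir1 := I1 _ rl'; have IrS := I2 _ rl'; have IcS := Ic _ rl'.
case: (row_end_step rl') => [[mE NE]|[mlt NE Nlt]]; last first.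
  suff -> : I r = N r by rewrite subrr mul0r.
  by move: nrem; rewrite /removable; lia.
suff -> : coef N (xcoord I) (iota 0 l) r = 0 by rewrite mulr0.
have IE : I r.+1 = (I r).+1 by move: nrem; rewrite /removable; lia.
apply/eqP; rewrite prodf_seq_eq0; apply/hasP; exists r.+1; first by rewrite mem_iota.
rewrite NE eqxx andbT IE -natrB // subSnn invr1 subrr eqxx andbT.
by lia.
Qed.

(** Induction on the last letter: raising [I r] multiplies the Vandermonde product by [coef] and
    divides the factorials by N r - I r; [sum_mul_coef] adds these contributions up to the walk
    length. *)
Lemma walk_count k I : strict_rows l m I -> component_rows I ->
  walk_length l m I = k ->
  (size (walk_words l m k I))%:R * (fact_ends I)%:R =
    (k`!)%:R * vandermonde N (xcoord I) (iota 0 l) :> rat.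
Proof.
elim: k I => [|k IH] I Istr Ic Ik.
  rewrite -hook_product_vandermonde // !mul1r /hook_product big1_seq ?mul1r //.
  move=> r /andP [_ rl]; rewrite big_geq //; move/eqP: Ik.
  by rewrite sum_nat_seq_eq0 => /allP /(_ r rl) /=; lia.
have [I1 I2] := Istr; have sep := strict_rows_separated Istr.
rewrite size_walk_words natr_sum mulr_suml.
transitivity (\sum_(r <- iota 0 l) (k`!)%:R * vandermonde N (xcoord I) (iota 0 l) *
    (((N r)%:R - (I r)%:R) * coef N (xcoord I) (iota 0 l) r)).
  rewrite big_mkcond big_seq [RHS]big_seq; apply: eq_bigr => r rl.
  have {}rl' : (r < l)%N by move: rl; rewrite mem_iota.
  case: ifP => rem; last by rewrite nonremovable_coef ?mulr0 ?rem.
  have FE : fact_ends I = ((N r - I r) * fact_ends (incr_row I r))%N.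
    rewrite !(bigD1_seq r) ?iota_uniq //= mulnA; congr muln.
      have := row_end_gt r; rewrite /incr_row eqxx; case/andP: rem => Irm _ mN.
      by have -> : (N r - I r = (N r - (I r + true)).+1)%N by lia.
    by apply: eq_bigr => t /negPf tr; rewrite /incr_row tr addn0.
  rewrite FE natrM mulrCA IH; last 3 first.
  - exact: strict_rows_incr.
  - exact: component_rows_incr.
  - by apply: succn_inj; rewrite -Ik -walk_length_incr.
  rewrite (eq_vandermonde _ (x' := fun t => (I t)%:R + (t == r)%:R)); last first.
    by move=> t _; rewrite /incr_row natrD.
  rewrite vandermonde_incr // natrB; first by ring.
  by apply: leq_trans (I1 r rl') _; apply: row_end_gt.
rewrite -mulr_sumr (sum_mul_coef (fun n => n%:R)) // sum_row_lengths // Ik factS natrM.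
by ring.
Qed.

Lemma hook_length_formula I : strict_rows l m I -> component_rows I ->
  let k := walk_length l m I in
  (size (walk_words l m k I))%:R = (k`!)%:R / (hook_product I)%:R :> rat.
Proof.
move=> Istr Ic k; have := walk_count Istr Ic erefl; rewrite -/k.
rewrite -hook_product_vandermonde // mulrA => /mulIf E.
have h0 : (hook_product I)%:R != 0 :> rat.
  rewrite Num.Theory.pnatr_eq0 -lt0n prodn_gt0 // => r.
  by rewrite prodn_gt0 // => j; lia.
rewrite -[LHS](mulfK h0); congr (_ / _); apply: E.
(* The Vandermonde product can be cancelled, being a factor of a nonzero product of factorials. *)
have : (fact_ends I)%:R != 0 :> rat.
  by rewrite Num.Theory.pnatr_eq0 -lt0n prodn_gt0 // => r; apply: fact_gt0.
by rewrite -hook_product_vandermonde // mulf_eq0 negb_or => /andP [].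
Qed.

End Hooks.

(** * Rows and subpaths of a Dyck path *)

Section DyckRows.
Local Open Scope nat_scope.
Variables (n : nat) (D : dyck n.+1).

(* Peaks of height 1 are kept, as empty rows: row_first = row_last + 1. *)
Definition row_first (r : nat) : nat := (falls D (nth 0 (peaks D) r)).+1.
Definition row_last (r : nat) : nat := (rises D (nth 0 (peaks D) r)).-1.

Local Notation l := (size (peaks D)).
Local Notation I := row_first.
Local Notation m := row_last.

Lemma risesS t : t < size D -> rises D t.+1 = rises D t + nth false D t.
Proof.
move=> tD; rewrite /rises (take_nth false) // -cats1 count_cat /= addn0.
by case: (nth _ _ _).
Qed.

Lemma rises_mono t t' : t <= t' -> rises D t <= rises D t'.
Proof.
move=> tt'; rewrite /rises -[in leqRHS](cat_take_drop t (take t' D)) take_takel //.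
by rewrite count_cat leq_addr.
Qed.

Lemma falls_mono t t' : t <= t' -> falls D t <= falls D t'.
Proof.
move=> tt'; rewrite /falls -[in leqRHS](cat_take_drop t (take t' D)) take_takel //.
by rewrite count_cat leq_addr.
Qed.

Lemma peak_rises k : k \in peaks D ->
  [/\ falls D k < rises D k, rises D k <= n.+1, k = rises D k + falls D k & k < size D].
Proof.
case/mem_peaks => k0 kD rk fk; have [sD rD lD] := dyckP D.
have E := rises_falls (ltnW kD); split=> //.
  have k1 : k.-1 < size D by lia.
  have := risesS k1; have := rises_falls (ltnW k1); rewrite rk prednK //.
  by have := lD k.-1; lia.
by rewrite -[leqRHS]rD rises_mono // -sD ltnW.
Qed.

Lemma nth_peak r : r < l -> nth 0 (peaks D) r \in peaks D.
Proof. exact: mem_nth. Qed.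

Lemma sorted_peaks : sorted ltn (peaks D).
Proof. exact: (sorted_filter ltn_trans _ (iota_ltn_sorted _ _)). Qed.

Lemma peak_nth_ltn r t : r < t -> t < l -> nth 0 (peaks D) r < nth 0 (peaks D) t.
Proof.
move=> rt tl; apply: (sorted_ltn_nth ltn_trans 0 sorted_peaks) => //.
exact: ltn_trans tl.
Qed.

Lemma row_peak r : r < l ->
  [/\ I r <= (m r).+1, (m r).+1 = rises D (nth 0 (peaks D) r) & m r <= n].
Proof.
by move=> rl; have [? ? _ _] := peak_rises (nth_peak rl); rewrite /I /m; split; lia.
Qed.

Lemma row_last_incr r : r.+1 < l -> m r < m r.+1.
Proof.
move=> rl; have rl' := ltnW rl.
have [_ lt] := peak_mono (nth_peak rl') (nth_peak rl) (peak_nth_ltn (ltnSn r) rl).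
by have [_ E1 _] := row_peak rl; have [_ E2 _] := row_peak rl'; lia.
Qed.

Lemma strict_rows_peaks : strict_rows l m I.
Proof.
split=> r rl; first by have [] := row_peak rl.
have rl' := ltnW rl.
by have [] := peak_mono (nth_peak rl') (nth_peak rl) (peak_nth_ltn (ltnSn r) rl).
Qed.

(** A single ascent lies between consecutive peaks k and k'. If it has one step, m grows by 1;
    otherwise it starts on the axis, which pushes [I r.+1] past m r + 1. *)
Lemma component_rows_peaks :
  (forall a l, is_ascent D a l -> 1 < l -> height D a = 0) ->
  component_rows l m I.
Proof.
move=> hD r rl; have rl' := ltnW rl.
have kk' := peak_nth_ltn (ltnSn r) rl.
have := nth_peak rl; have := nth_peak rl'.
have [_ mE' _] := row_peak rl; have [_ mE _] := row_peak rl'.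
rewrite mE /I; move: mE mE'.
have between q : nth 0 (peaks D) r < q -> q < nth 0 (peaks D) r.+1 -> q \notin peaks D.
  move=> rq qr; apply/negP => qD.
  have [t tl tq] : exists2 t, t < l & nth 0 (peaks D) t = q.
    by exists (index q (peaks D)); rewrite ?index_mem ?nth_index.
  move: rq qr; rewrite -tq; case: (ltngtP t r) => [lt|gt|->]; last by lia.
    by have := peak_nth_ltn lt rl'; lia.
  have [<-|ne] := eqVneq t r.+1; first by lia.
  by have := @peak_nth_ltn r.+1 t; lia.
move: (nth 0 _ r) (nth 0 _ r.+1) between kk' => k k' between kk' mE mE' kD k'D.
have [_ kD' _ /negPf fk] := mem_peaks kD; have [_ k'D' rk' /negPf fk'] := mem_peaks k'D.
have toF t : t < size D -> nth true D t = nth false D t.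
  by move=> tD; apply: set_nth_default.
rewrite toF // in fk; rewrite toF // in fk'.
(* With no peak strictly between k and k', a rise there is followed by rises up to k'. *)
have up t : k < t -> t.+1 < k' -> nth false D t -> nth false D t.+1.
  move=> kt tk' rt; apply: contraNT (between t.+1 (ltnW kt) tk') => ft.
  by rewrite mem_filter mem_iota /= rt toF ?ft /=; lia.
have ex : exists t, (k < t) && nth false D t.
  exists k'.-1; rewrite rk' andbT ltnNge; apply/negP => h.
  have E : k'.-1 = k by lia.
  by rewrite E fk in rk'.
case: (ex_minnP ex) => a /andP [ka ra] amin.
have ak' : a < k'.
  have kk1 : k < k'.-1.
    rewrite ltnNge; apply/negP => h; have E : k'.-1 = k by lia.
    by rewrite E fk in rk'.
  by have := amin k'.-1; rewrite kk1 rk' => /(_ isT); lia.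
have fa t : k <= t -> t < a -> nth false D t = false.
  move=> kt ta; have [<-//|ne] := eqVneq k t.
  by apply/negP => rt; have := amin t; rewrite rt andbT; lia.
have asc : is_ascent D a (k' - a).
  split; try lia.
  - move=> t; elim: t => [|t IH] /andP [at_ tk']; first by have -> : 0 = a by lia.
    have [<-//|ne] := eqVneq a t.+1.
    by apply: up; [lia|lia|apply: IH; lia].
  - by right; rewrite toF ?fa //; lia.
  - by rewrite subnKC // ltnW.
have [lt|le] := ltnP 1 (k' - a).
  (* Height 0 means that rises are at most falls at a; monotonicity carries this to k and k'. *)
  right; have := hD _ _ asc lt; rewrite /height => h0.
  by have := rises_mono (ltnW ka); have := falls_mono (ltnW ak'); lia.
left; have aE : k' = a.+1 by lia.
have flat t : k <= t -> t <= a -> rises D t = rises D k.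
  elim: t => [|t IH]; first by rewrite leqn0 => /eqP ->.
  rewrite leq_eqVlt => /orP [/eqP -> //|kt] ta.
  by rewrite risesS ?IH ?fa //; lia.
by move: mE'; rewrite aE risesS ?flat ?ra //; lia.
Qed.

Lemma rows_word_peaks : psi_word n D = rows_word m I (iota 0 l).
Proof.
have -> : rows_word m I (iota 0 l) =
    flatten [seq block_word ((falls D k).+1, (rises D k).-1) | k <- peaks D].
  by rewrite /rows_word -[in RHS](mkseq_nth 0 (peaks D)) /mkseq -map_comp.
have sub : {subset peaks D <= peaks D} by [].
rewrite /psi_word /peak_blocks; elim: {1 3 4}(peaks D) sub => //= k s IH sub.
rewrite map_cat flatten_cat IH => [|t ts]; last by apply: sub; rewrite inE ts orbT.
congr cat; have kD := sub k (mem_head _ _).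
rewrite (eq_in_filter (a2 := pred1 ((falls D k).+1, (rises D k).-1))); last first.
  by move=> b bn; rewrite /= (peak_block kD bn).
case: (boolP (((falls D k).+1, (rises D k).-1) \in blocks n)) => h.
  by rewrite filter_pred1_uniq ?uniq_blocks //= cats0.
(* The remaining case is a peak of height 1, whose row is empty. *)
rewrite (_ : [seq b <- _ | _] = [::]) /=; last first.
  apply/eqP; rewrite -[_ == _]negbK -has_filter; apply/hasPn => b bn.
  by apply: contraNneq h => <-.
have [] := peak_rises kD; move: h; rewrite mem_blocks /= /block_word /= => h h1 h2 _ _.
by have -> : (rises D k).-1.+1 - (falls D k).+1 = 0 by lia.
Qed.

Lemma walk_length_peaks :
  walk_length l m I = \sum_(x <- peaks D) height D x - size (peaks D).
Proof.
have -> : walk_length l m I = \sum_(x <- peaks D) (height D x).-1.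
  rewrite -[in RHS](mkseq_nth 0 (peaks D)) /mkseq big_map /walk_length.
  rewrite big_seq [RHS]big_seq; apply: eq_bigr => r; rewrite mem_iota => rl.
  by have [_ -> _] := row_peak rl; rewrite /height /I; lia.
have -> : size (peaks D) = \sum_(x <- peaks D) 1 by rewrite sum1_size.
rewrite big_seq [X in X - _]big_seq [X in _ - X]big_seq -sumnB => [|x].
  by apply: eq_bigr => x _; rewrite subn1.
by case/peak_rises; rewrite /height subn_gt0.
Qed.

Lemma ascent_blocks_rows :
  perm_eq (ascent_blocks n D)
          [seq (I r, j) | r <- iota 0 l, j <- index_iota (I r) (m r).+1].
Proof.
have [I1 I2] := strict_rows_peaks.
apply: uniq_perm; first by rewrite filter_uniq // uniq_blocks.
  apply: allpairs_uniq_dep => [|r _|]; rewrite ?iota_uniq //.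
  move=> p p' /allpairsPdep [r [j [+ _ ->]]] /allpairsPdep [r' [j' [+ _ ->]]] /=.
  rewrite !mem_iota /= => rl rl' [E ->]; congr existT.
  case: (ltngtP r r') => // lt.
  - by have := ltn_homo I2 lt rl'; rewrite /I E ltnn.
  - by have := ltn_homo I2 lt rl; rewrite /I E ltnn.
case=> i j; rewrite mem_filter mem_blocks /=.
apply/andP/allpairsPdep => [[/hasP [k kD] on_k /and3P [i0 ij jn]]|].
  have [h1 h2 h3 h4] := peak_rises kD.
  move: on_k; rewrite /on_extended_ascent /block_left /block_top /height /= => on_k.
  have kE : nth 0 (peaks D) (index k (peaks D)) = k by apply: nth_index.
  exists (index k (peaks D)), j; rewrite mem_iota index_mem kD; split=> //.
    by rewrite mem_index_iota /I /m kE; lia.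
  by congr pair; rewrite /I kE; lia.
case=> r [j' [+ + [-> ->]]]; rewrite mem_iota mem_index_iota /= => rl jr.
have kD := nth_peak rl; have [h1 h2 h3 h4] := peak_rises kD.
have [? mE mn] := row_peak rl; split; last by rewrite /=; lia.
apply/hasP; exists (nth 0 (peaks D) r) => //.
move: jr mE; rewrite /on_extended_ascent /block_left /block_top /height /I /=.
by move: (m r) (nth 0 _ r) h1 h2 h3 h4 {kD} mn => mr k; lia.
Qed.

(** J labels the falling line through (x, y + 1), which carries the tops of the blocks with second
    index J; ascent t lies on the line of slope 1 from (2 I t - 2, 0). The point is on or right of
    the line of ascent r and strictly left of that of ascent r + 1, so only the latter can be hit
    next; it is long enough because [J <= m r < m r.+1]. *)
Lemma hit_next_row x y r J : r < l -> x + y.+1 = J.*2.+2 -> J <= m r ->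
  (I r).*2 + y.+1 <= x.+2 -> (r.+1 < l -> x.+2 < (I r.+1).*2 + y.+1) ->
  has (fun k => on_extended_ascent D k (x.+1, y)) (peaks D) =
  (r.+1 < l) && (x.+3 == (I r.+1).*2 + y).
Proof.
move=> rl xy Jm Ixy Ixy'; have [I1 I2] := strict_rows_peaks.
apply/hasP/andP => [[k kD on_k]|[rl' /eqP xE]].
  have [h1 h2 h3 h4] := peak_rises kD.
  have [t tl kE] : exists2 t, t < l & nth 0 (peaks D) t = k.
    by exists (index k (peaks D)); rewrite ?index_mem ?nth_index.
  have It : x.+3 = (I t).*2 + y.
    by move: on_k; rewrite /on_extended_ascent /height /I kE /=; lia.
  have rt : r < t.
    case: (ltngtP r t) => // [tr|rE]; last by rewrite rE in Ixy; lia.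
    by have := ltn_homo I2 tr rl; lia.
  have rl' : r.+1 < l by apply: leq_ltn_trans tl.
  split=> //; have := Ixy' rl'.
  have [tE|ne] := eqVneq t r.+1; first by rewrite It tE.
  by have := ltn_homo I2 (r := r.+1) (t := t); lia.
have kD := nth_peak rl'; exists (nth 0 (peaks D) r.+1) => //.
have [h1 h2 h3 h4] := peak_rises kD.
have [_ mE _] := row_peak rl'; have mlt := row_last_incr rl'.
move: xE mE mlt; rewrite /on_extended_ascent /height /I /=.
move: (nth 0 _ r.+1) h1 h2 h3 h4 {kD Ixy Ixy'} => k; lia.
Qed.

(** Falling line J meets the line of ascent r + 1 at height J + 2 - I r.+1, positive exactly when
    the test in [leg] succeeds. The rise taken there leads to line J + 1, as in the recursive call
    of [leg]. *)
Lemma count_descent fuel x y r J : r < l -> x + y = J.*2.+2 -> J <= m r ->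
  (I r).*2 + y <= x.+2 -> (r.+1 < l -> x.+2 < (I r.+1).*2 + y) ->
  (size D).+2 <= fuel + x ->
  count_mem true (descent D fuel x y) =
    leg [seq I t | t <- iota r.+1 (l - r.+1)] J.
Proof.
have [I1 I2] := strict_rows_peaks.
have laterE r' : r'.+1 < l -> [seq I t | t <- iota r'.+1 (l - r'.+1)] =
    I r'.+1 :: [seq I t | t <- iota r'.+2 (l - r'.+2)].
  by move=> rl; have -> : l - r'.+1 = (l - r'.+2).+1 by lia.
have later0 r' : r' < l -> ~~ (r'.+1 < l) -> [seq I t | t <- iota r'.+1 (l - r'.+1)] = [::].
  by move=> rl rl'; have -> : l - r'.+1 = 0 by lia.
elim: fuel x y r J => [|fuel IH] x y r J rl xy Jm Ixy Ixy' fx.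
  (* The fuel cannot run out: x is at most 2J + 2, hence at most the length 2n + 2 of D. *)
  by have [sD _ _] := dyckP D; have [_ _ mn] := row_peak rl; lia.
case: y xy Ixy Ixy' => [|y] xy Ixy Ixy' /=.
  have [rl'|rl'] := boolP (r.+1 < l); last by rewrite later0.
  by rewrite laterE //= ifF //; have := Ixy' rl'; lia.
rewrite (hit_next_row rl xy Jm Ixy Ixy').
have [y0|y0] := posnP y.
  rewrite y0 /= (_ : descent D fuel x.+1 0 = [::]); last by case: (fuel).
  have [rl'|rl'] := boolP (r.+1 < l); last by rewrite later0.
  by rewrite laterE //= ifF //; have := Ixy' rl'; lia.
case: ifP => [/andP [_ /andP [rl' /eqP xE]]|/= hit] /=.
  have mlt := row_last_incr rl'.
  rewrite laterE //= ifT; last by lia.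
  rewrite add0n add1n (IH _ _ r.+1 J.+1) //; try lia.
  by move=> rl''; have := I2 _ rl''; lia.
by rewrite add0n (IH _ _ r J) //; try lia.
Qed.

(** The opening run has j - I r + 2 rises; subtracting 1 leaves the arm plus one. *)
Lemma p_hook r j : r < l -> I r <= j < (m r).+1 ->
  p_ D (I r) j = j - I r + 1 + leg [seq I t | t <- iota r.+1 (l - r.+1)] j.
Proof.
move=> rl jr; have [I1 I2] := strict_rows_peaks.
have I0 : 0 < I r by [].
rewrite /p_ /subpath /= count_cat count_nseq mul1n (@count_descent _ _ _ r j) //; try lia.
by move=> rl'; have := I2 r rl'; lia.
Qed.

Lemma prod_p : \prod_(b <- ascent_blocks n D) p_ D b.1 b.2 = hook_product l m I.
Proof.
rewrite (perm_big _ ascent_blocks_rows) big_allpairs_dep /=.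
rewrite /hook_product big_seq [RHS]big_seq; apply: eq_bigr => r; rewrite mem_iota => rl.
rewrite big_seq [RHS]big_seq; apply: eq_bigr => j; rewrite mem_index_iota => jr.
exact: p_hook.
Qed.

End DyckRows.

(** * Dimension of the homogeneous module *)

Lemma dim_homogeneous_module (F : fieldType) al (C : homogeneous_component al) :
  \dim {: homogeneous_module F C} = #|hcomp_set C|.
Proof.
rewrite dimvf /homogeneous_module /=.
rewrite [LHS](_ : _ = #|{: {w : Ialpha al | w \in hcomp_set C}}| * 1)%N //.
by rewrite muln1 card_sig.
Qed.

Theorem proposition3p2 (F : fieldType) (n : nat) (hn : (1 <= n)%N)
    (D : dyck n.+1)
    (hD : forall a l : nat, is_ascent D a l -> (1 < l)%N -> height D a = 0%N) :
  let k := (\sum_(x <- peaks D) height D x - size (peaks D))%N in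
  (\dim {: homogeneous_module F (Psi D)})%:R =
    (k`!)%:R / (\prod_(b <- ascent_blocks n D) p_ D b.1 b.2)%:R :> rat.
Proof.
move=> k; have Istr := strict_rows_peaks D; have Ic := component_rows_peaks hD.
have m_incr := @row_last_incr n D.
rewrite dim_homogeneous_module prod_p /k -walk_length_peaks.
rewrite -(hook_length_formula m_incr Istr Ic); congr (_%:R).
apply: card_commutation_class; first exact: uniq_walk_words Istr.
by move=> u; rewrite /= rows_word_peaks; apply: mem_walk_words.
Qed.
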